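(* Let $\mu$ be doubling and let $X$ be a quasi-Banach function lattice over $(\mathcal P,\mu)$. Suppose that $\mathcal P$ supports a $p$-Poincaré inequality with dilation constant $\lambda\ge1$, where $p>s$ and $s$ is such that the dimension condition holds with exponent $s$. Suppose further that $X\hookrightarrow L^p_{\mathrm{loc}}$. Then there is a constant $C>0$ such that the following holds for every fixed ball $B_0\subset\mathcal P$ of radius $R>0$. There is a constant $c_{B_0}>0$ such that for every ball $B\subset B_0$ of radius $r\in(0,R)$, $$C_X\text{-}\operatorname*{ess\,sup}_{x\in B}|u(x)-u_B|\le C\,\frac{c_{\mathrm{emb}}(2\lambda B)\,r}{\mu(2\lambda B)^{1/p}}\,\|g\chi_{2\lambda B}\|_X \quad\text{and}\quad \frac{c_{\mathrm{emb}}(2\lambda B)\,r}{\mu(2\lambda B)^{1/p}}\,\|g\chi_{2\lambda B}\|_X\le c_{B_0}\,r^{1-s/p}\,\|g\chi_{2\lambda B}\|_X$$ whenever $g\in X$ is an $X$-weak upper gradient of $u\in N^1X$. Moreover, $c_{B_0}$ can be chosen with $$C^{-1}K\le c_{B_0}\le C K,\qquad K=c_{\mathrm{emb}}(2\lambda B_0)\Bigl(\frac{R^s}{\mu(2\lambda B_0)}\Bigr)^{1/p}.$$ The constant $C$ is independent of $B_0$, $R$, $B$, $r$, $u$ and $g$.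
   Context: Setting. $\mathcal P=(\mathcal P,\mathrm d,\mu)$ is a metric space with a $\sigma$-finite Borel regular measure $\mu$ (all Borel sets are $\mu$-measurable, and every $\mu$-measurable set $A$ is contained in a Borel set $D$ with $\mu(D)=\mu(A)$) such that every ball has finite positive measure. A ball $B=B(x,r)$ is open and comes with its center and radius; $\lambda B=B(x,\lambda r)$. $u_B=\mu(B)^{-1}\int_Bu\,d\mu$. $\mathcal M(\mathcal P,\mu)$ is the set of all extended real-valued $\mu$-measurable functions on $\mathcal P$ (defined everywhere). Quasi-Banach function lattice: a linear space $X=\{u\in\mathcal M(\mathcal P,\mu):\|u\|_X<\infty\}$ given by a functional $\|\cdot\|_X:\mathcal M(\mathcal P,\mu)\to[0,\infty]$ such that: $\|u\|_X=0$ iff $u=0$ a.e.; $\|au\|_X=|a|\,\|u\|_X$ for $a\in\mathbb R$; there is a constant $c_\triangle\ge1$ with $\|u+v\|_X\le c_\triangle(\|u\|_X+\|v\|_X)$; if $|u|\le|v|$ a.e. then $\|u\|_X\le\|v\|_X$; and (Riesz--Fischer) if $u_n\ge0$ a.e. for all $n$ then $\|\sum_{n=1}^\infty u_n\|_X\le\sum_{n=1}^\infty c_\triangle^n\|u_n\|_X$. The quasi-norm is also assumed continuous: $\|u_n-u\|_X\to0$ implies $\|u_n\|_X\to\|u\|_X$. Newtonian space. A curve is a non-constant continuous map $\gamma$ from a compact interval into $\mathcal P$ of finite length, parametrized by arc length $ds$ on $[0,l_\gamma]$. A Borel function $g:\mathcal P\to[0,\infty]$ is an upper gradient of $u:\mathcal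 P\to[-\infty,\infty]$ if $|u(\gamma(0))-u(\gamma(l_\gamma))|\le\int_\gamma g\,ds$ for every curve $\gamma$, with the convention $|(\pm\infty)-(\pm\infty)|=\infty$. A measurable $g:\mathcal P\to[0,\infty]$ is an $X$-weak upper gradient of $u$ if this inequality holds for $\mathrm{Mod}_X$-a.e. curve, i.e. for all curves except a family $\Gamma_e$ for which there is a nonnegative Borel function $\rho\in X$ with $\int_\gamma\rho\,ds=\infty$ for all $\gamma\in\Gamma_e$. Set $\|u\|_{N^1X}=\|u\|_X+\inf_g\|g\|_X$, infimum over all upper gradients $g$ of $u$, and $N^1X=\{u\in\mathcal M(\mathcal P,\mu):\|u\|_{N^1X}<\infty\}$. Capacity. $C_X(E)=\inf\{\|u\|_{N^1X}:u\ge1\text{ on }E\}$. $C_X\text{-}\operatorname{ess\,sup}_{x\in B}f(x)$ is the infimum of all $a$ such that $C_X(\{x\in B:f(x)>a\})=0$. Doubling: there is $c_{\mathrm{dbl}}\ge1$ with $\mu(2B)\le c_{\mathrm{dbl}}\mu(B)$ for every ball $B$. Dimension condition with exponent $s>0$: there is $c_s>0$ with $\mu(B(y,r))/\mu(B(x,R))\ge c_s(r/R)^s$ whenever $0<r\le R$, $x\in\mathcal P$, $y\in B(x,R)$. $p$-Poincaré inequality ($p\in[1,\infty)$): there are $c_{\mathrm{PI}}>0$ and $\lambda\ge1$ such that $\frac1{\mu(B)}\int_B|u-u_B|\,d\mu\le c_{\mathrm{PI}}\,\mathrm{diam}(B)\bigl(\frac1{\mu(\lambda B)}\int_{\lambda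 B}g^p\,d\mu\bigr)^{1/p}$ for all balls $B$, all $u\in L^1_{\mathrm{loc}}(\mathcal P)$ and all upper gradients $g$ of $u$. Embedding $X\hookrightarrow L^p_{\mathrm{loc}}$: for every ball $B$ there is a constant $c_{\mathrm{emb}}(B)>0$ with $\|u\chi_B\|_{L^p}\le c_{\mathrm{emb}}(B)\|u\chi_B\|_X$ for all $u\in\mathcal M(\mathcal P,\mu)$; $c_{\mathrm{emb}}(B)$ denotes the smallest such constant.
   Formalization: The choice of c_{B_0} with C^{-1}K ≤ c_{B_0} ≤ CK is asserted for balls B ⊂ B_0 with also 2λB ⊂ 2λB_0 (automatic if r ≤ R/2 or in length spaces), since it can fail otherwise; for all B ⊂ B_0 the estimates hold with some c_{B_0} > 0. *)

(* Defs.v *)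
From HB Require Import structures.
From mathcomp Require Import all_boot all_order all_algebra.
From mathcomp Require Import all_classical all_reals all_analysis measurable_realfun.

Set Implicit Arguments.
Unset Strict Implicit.
Unset Printing Implicit Defensive.

Import Order.TTheory GRing.Theory Num.Theory.
Import numFieldNormedType.Exports.

Local Open Scope classical_set_scope.
Local Open Scope ring_scope.

(* A type with both a metric and a sigma-algebra; the two are only related by
   [metric_measure_space] below.  [measurable] plays the role of the
   mu-measurable sets, and [<<s open>>] that of the Borel sets. *)
#[short(type="metricMeasurableType")]
HB.structure Definition MetricMeasurable (d : measure_display)
  (R : numDomainType) := {T of Metric R T & Measurable d T}.

Section metric_measure.
Local Open Scope ereal_scope.
Context (R : realType) (d : measure_display) (P : metricMeasurableType d R).
Variable mu : {measure set P -> \bar R}.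

Definition borel_set (A : set P) := <<s (@open P) >> A.

Definition borel_fun (g : P -> \bar R) :=
  measurable_fun [set: g_sigma_algebraType (@open P)]
    (g : g_sigma_algebraType (@open P) -> \bar R).

Record metric_measure_space : Prop := {
  mms_sigma_finite : sigma_finite [set: P] mu ;
  mms_borel : forall A : set P, borel_set A -> d.-measurable A ;
  mms_regular : forall A : set P, d.-measurable A ->
    exists D : set P, [/\ borel_set D, A `<=` D & mu D = mu A] ;
  mms_ball : forall (x : P) (r : R), (0 < r)%R -> 0 < mu (ball x r) < +oo }.

Definition doubling := exists2 c : R, (1 <= c)%R &
  forall (x : P) (r : R), (0 < r)%R ->
    mu (ball x (2 * r)) <= c%:E * mu (ball x r).

Definition dimension_condition (s : R) := exists2 c : R, (0 < c)%R &
  forall (x y : P) (r R0 : R), (0 < r)%R -> (r <= R0)%R -> ball x R0 y ->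
    (c * (r / R0) `^ s <= fine (mu (ball y r)) / fine (mu (ball x R0)))%R.

Definition mean (A : set P) (u : P -> \bar R) : \bar R :=
  (\int[mu]_(x in A) u x) / mu A.

Definition diam (A : set P) : \bar R :=
  ereal_sup [set (mdist x y)%:E | x in A & y in A].

(* Local integrability means integrability on every ball. *)
Definition L1loc (u : P -> \bar R) :=
  forall (x : P) (r : R), (0 < r)%R -> mu.-integrable (ball x r) u.

Definition curve_length (gamma : R -> P) (a b : R) : \bar R :=
  ereal_sup [set (\sum_(0 <= i < size t)
      mdist (gamma (nth b (a :: t) i)) (gamma (nth b (a :: t) i.+1)))%R%:E
    | t in itv_partition a b].

(* Rectifiable non-constant curves, represented by their arc-length
   parametrization; the values of [curve_map] outside [0, curve_len] are
   irrelevant. *)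
Record curve := Curve {
  curve_len : R ;
  curve_map :> R -> P ;
  curve_len_ge0 : (0 <= curve_len)%R ;
  curve_continuous : {within `[0%R, curve_len], continuous curve_map} ;
  curve_nonconstant :
    exists2 t : R, t \in `[0%R, curve_len] & curve_map t <> curve_map 0%R ;
  curve_arc_length : forall t : R, t \in `[0%R, curve_len] ->
    curve_length curve_map 0 t = t%:E }.

(* For g >= 0, [integral] is the supremum of the integrals of the measurable
   simple functions below g, so that this is meaningful even when g \o gamma is
   not Borel. *)
Definition line_integral (gamma : curve) (g : P -> \bar R) : \bar R :=
  \int[lebesgue_measure]_(t in `[0%R, curve_len gamma]) g (gamma t).

(* In [\bar R], both infinities satisfy `|x - x| = +oo (as oo - oo = -oo), which
   is the convention required here when u takes infinite values at the end
   points. *)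
Definition upper_gradient_along (g u : P -> \bar R) (gamma : curve) :=
  `|u (gamma 0%R) - u (gamma (curve_len gamma))| <= line_integral gamma g.

Definition upper_gradient (g u : P -> \bar R) :=
  [/\ borel_fun g, forall x, 0 <= g x &
      forall gamma : curve, upper_gradient_along g u gamma].

Definition poincare (p lambda : R) := exists2 c : R, (0 < c)%R &
  forall (x : P) (r : R), (0 < r)%R -> forall u g : P -> \bar R,
    L1loc u -> upper_gradient g u ->
    mean (ball x r) (fun y => `|u y - mean (ball x r) u|) <=
    c%:E * diam (ball x r) *
      (mean (ball x (lambda * r)) (fun y => g y `^ p)) `^ p^-1.

(* A function lattice is given by its functional [N] on the measurable
   functions P -> [-oo, +oo]: it is the space of those u with N u < +oo.  The
   values of [N] at non-measurable functions are irrelevant. *)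
Record quasi_Banach_function_lattice (c : R) (N : (P -> \bar R) -> \bar R)
    : Prop := {
  qbfl_modulus : (1 <= c)%R ;
  qbfl_ge0 : forall u, measurable_fun [set: P] u -> 0 <= N u ;
  qbfl_eq0 : forall u, measurable_fun [set: P] u ->
    N u = 0 <-> {ae mu, forall x, u x = 0} ;
  qbfl_homogeneous : forall (a : R) u, measurable_fun [set: P] u ->
    N (fun x => a%:E * u x) = `|a|%:E * N u ;
  qbfl_triangle : forall u v,
    measurable_fun [set: P] u -> measurable_fun [set: P] v ->
    N (u \+ v) <= c%:E * (N u + N v) ;
  qbfl_lattice : forall u v,
    measurable_fun [set: P] u -> measurable_fun [set: P] v ->
    {ae mu, forall x, `|u x| <= `|v x|} -> N u <= N v ;
  qbfl_riesz_fischer : forall u_ : (P -> \bar R)^nat,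
    (forall n, measurable_fun [set: P] (u_ n)) ->
    (forall n, {ae mu, forall x, 0 <= u_ n x}) ->
    N (fun x => \sum_(1 <= n <oo) u_ n x) <=
      \sum_(1 <= n <oo) (c ^+ n)%:E * N (u_ n) ;
  qbfl_continuous : forall (u_ : (P -> \bar R)^nat) u,
    (forall n, measurable_fun [set: P] (u_ n)) -> measurable_fun [set: P] u ->
    N (u_ n \- u) @[n --> \oo] --> 0 ->
    N (u_ n) @[n --> \oo] --> N u }.

Variable N : (P -> \bar R) -> \bar R.

Definition in_lattice (u : P -> \bar R) :=
  measurable_fun [set: P] u /\ N u < +oo.

Definition exceptional (Gamma : set curve) := exists rho : P -> \bar R,
  [/\ borel_fun rho, forall x, 0 <= rho x, in_lattice rho &
      forall gamma, Gamma gamma -> line_integral gamma rho = +oo].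

Definition weak_upper_gradient (g u : P -> \bar R) :=
  [/\ measurable_fun [set: P] g, forall x, 0 <= g x &
      exists2 Gamma : set curve, exceptional Gamma &
        forall gamma, ~ Gamma gamma -> upper_gradient_along g u gamma].

Definition newtonian_norm (u : P -> \bar R) : \bar R :=
  N u + ereal_inf [set N g | g in [set g | upper_gradient g u]].

Definition in_newtonian (u : P -> \bar R) :=
  measurable_fun [set: P] u /\ newtonian_norm u < +oo.

Definition capacity (E : set P) : \bar R :=
  ereal_inf [set newtonian_norm u | u in
    [set u | measurable_fun [set: P] u /\ forall x, E x -> 1 <= u x]].

Definition cap_ess_sup (B : set P) (f : P -> \bar R) : \bar R :=
  ereal_inf [set a%:E | a in
    [set a : R | capacity [set x | B x /\ a%:E < f x] = 0]].

Definition embedding_bound (p : R) (B : set P) (c : R) := (0 < c)%R /\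
  forall u, measurable_fun [set: P] u ->
    'N[mu]_(p%:E)[u \_ B] <= c%:E * N (u \_ B).

(* [N] embeds into the locally p-integrable functions, and [cemb x r] is the
   smallest positive admissible constant for [ball x r].  Such a constant exists
   as soon as the norm is neither 0 nor +oo on some function supported in the
   ball; otherwise every c > 0 is admissible and there is no smallest one. *)
Definition embeds_Lploc (p : R) (cemb : P -> R -> R) :=
  forall (x : P) (r : R), (0 < r)%R ->
    embedding_bound p (ball x r) (cemb x r) /\
    forall c : R, embedding_bound p (ball x r) c -> (cemb x r <= c)%R.

End metric_measure.

(* Main.v *)
(** The Poincare inequality bounds the mean oscillation of [u] on a ball of
    radius [t] contained in a fixed ball of radius [r] by a multiple of
    [(t / r) `^ (1 - s / p)], because the dimension condition controls how fast
    the measure of small balls decays.  As [s < p], telescoping over the radii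
    [r / 2 ^+ i] bounds all averages [u_B(y, r / 2 ^+ i) - u_B(x, r)] by the same
    constant multiple of [r (mean of h^p on 2 lambda B) `^ p^-1]; covering [B] by
    balls of a maximal separated set then bounds [|u - u_B|] by that constant
    almost everywhere.

    The exceptional null set [E] also has capacity zero.  If [h] is a Borel upper
    gradient of [u] and [E'] is a Borel null set containing [E], put
    [rho = h + oo * 1_E'].  Along a curve with an end point in [E], either
    [int h = oo], or [u] is continuous along the curve, which then stays in [E]
    for a positive time; in both cases [int rho = oo].  Hence every positive
    multiple of [rho] is an upper gradient of [1_E].

    A weak upper gradient [g] is replaced by [g' + e rho], where [g' >= g] is a
    Borel function equal to [g] almost everywhere and [rho] has infinite integral
    along the exceptional curves; then [e] tends to 0. *)

Require Import Defs.
From HB Require Import structures.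
From mathcomp Require Import all_boot all_order all_algebra.
From mathcomp Require Import all_classical all_reals all_analysis measurable_realfun.
From mathcomp Require Import unstable ring lra.

Set Implicit Arguments.
Unset Strict Implicit.
Unset Printing Implicit Defensive.

Import Order.TTheory GRing.Theory Num.Theory.
Import numFieldNormedType.Exports.

Local Open Scope classical_set_scope.
Local Open Scope ring_scope.

(** * Subcurves *)

Section chains.
Context (R : realType) (d : measure_display) (P : metricMeasurableType d R).
Implicit Types (f : R -> P) (a b c : R) (t : seq R).

(** Structural recursion in place of the indexed sum in [curve_length], so that partitions can be
    treated by induction on the list. *)
Fixpoint chain f a t : R :=
  if t is x :: t' then mdist (f a) (f x) + chain f x t' else 0.

Lemma sum_chain f a b t :
  \sum_(0 <= i < size t)
    mdist (f (nth b (a :: t) i)) (f (nth b (a :: t) i.+1)) = chain f a t.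
Proof.
elim: t a => [|x t ih] a; first by rewrite big_nil.
by rewrite /= big_nat_recl//= ih.
Qed.

Lemma chain_rcons f a t x :
  chain f a (rcons t x) = chain f a t + mdist (f (last a t)) (f x).
Proof. by elim: t a => [|y t ih] a //=; rewrite ?addr0 ?add0r// ih addrA. Qed.

Lemma chain_comp f (phi : R -> R) a t :
  chain (f \o phi) a t = chain f (phi a) (map phi t).
Proof. by elim: t a => //= x t ih a; rewrite ih. Qed.

(** Inserting [c] only lengthens a chain: the triangle inequality applies to the single link that
    [c] cuts, and all other links are unchanged. *)
Lemma chain_split f a c t : a <= c -> path <%R a t ->
  chain f a t <= chain f a (itv_partitionL t c) + chain f c (itv_partitionR t c).
Proof.
rewrite /itv_partitionL /itv_partitionR.
elim: t a => [|x t ih] a ac /=; first by rewrite !addr_ge0// ?mdist_ge0.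
move=> /andP[ax xt]; have [xc|cx|xc] := ltgtP x c.
- by rewrite /= -addrA lerD2l ih// ltW.
- rewrite path_lt_filter0//=; last exact: path_lt_head xt.
  rewrite path_lt_filterT//=; last exact: path_lt_head xt.
  by rewrite addr0 addrA lerD2r metric_triangle.
- move: xt; rewrite xc => xt; rewrite path_lt_filter0//= path_lt_filterT//.
  by rewrite addr0.
Qed.

Lemma curve_lengthE f a b :
  curve_length f a b = ereal_sup [set (chain f a t)%:E | t in itv_partition a b].
Proof.
by congr ereal_sup; apply: eq_imagel => t _; rewrite sum_chain.
Qed.

Lemma chain_le_curve_length f a b t : itv_partition a b t ->
  ((chain f a t)%:E <= curve_length f a b)%E.
Proof.
by move=> abt; rewrite curve_lengthE; apply: ereal_sup_ubound; exists t.
Qed.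

Lemma curve_length_adherent f a b (l e : R) : curve_length f a b = l%:E ->
  0 < e -> exists2 t, itv_partition a b t & l - e < chain f a t.
Proof.
rewrite curve_lengthE => fl e0.
have fin : ereal_sup [set (chain f a t)%:E | t in itv_partition a b]
    \is a fin_num by rewrite fl.
have [_ [t abt <-]] := ub_ereal_sup_adherent e0 fin.
by rewrite fl -EFinB lte_fin; exists t.
Qed.

Lemma chain_lipschitz f a b k (A : set R) t :
  (forall x y, A x -> A y -> x <= y -> mdist (f x) (f y) <= k * (y - x)) ->
  (`[a, b] `<=` A)%classic -> itv_partition a b t -> chain f a t <= k * (b - a).
Proof.
move=> lip; elim: t a => [|x t ih] a aA abt.
  by rewrite (itv_partition_nil abt) subrr mulr0.
have xb := itv_partition_le (itv_partition_cons abt).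
have ax : a < x by case: abt => /= /andP[].
have ab := lt_le_trans ax xb.
rewrite (_ : k * (b - a) = k * (x - a) + k * (b - x)); last by ring.
rewrite /= lerD//.
  by apply: lip => //; [apply: aA|apply: aA|exact: ltW] => /=;
    rewrite in_itv/= ?lexx ?(ltW ax) ?(ltW ab) ?xb.
apply: ih (itv_partition_cons abt) => y /=; rewrite in_itv/= => /andP[xy yb].
by apply: aA; rewrite /= in_itv/= yb (le_trans (ltW ax)).
Qed.

Lemma itv_partition_shift a b c t :
  itv_partition a b t -> itv_partition (c + a) (c + b) (map (+%R c) t).
Proof.
move=> [pt /eqP lt]; split; last by rewrite last_map lt.
by rewrite path_map; apply: sub_path pt => x y /=; rewrite ltrD2l.
Qed.

End chains.

Section subcurves.
Context (R : realType) (d : measure_display) (P : metricMeasurableType d R).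
Implicit Types (gamma : curve P) (a b : R).

(** A nearly optimal partition of [[0, a]] followed by [b] is a partition of [[0, b]], so its chain
    is at most [b]; the last link is what remains. *)
Lemma curve_lipschitz gamma a b : 0 <= a -> a <= b -> b <= curve_len gamma ->
  mdist (gamma a) (gamma b) <= b - a.
Proof.
move=> a0; rewrite le_eqVlt => /predU1P[<- _|ab bl].
  by rewrite mdistxx subrr.
have al : curve_length gamma 0 a = a%:E.
  by apply: curve_arc_length; rewrite in_itv/= a0 (le_trans (ltW ab)).
have bl' : curve_length gamma 0 b = b%:E.
  by apply: curve_arc_length; rewrite in_itv/= bl (le_trans a0 (ltW ab)).
apply/ler_addgt0Pr => e e0.
have [t at_ aet] := curve_length_adherent al e0.
have bt : itv_partition 0 b (rcons t b).
  by rewrite -cats1; apply: itv_partition_cat at_ (itv_partition1 ab).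
have := chain_le_curve_length gamma bt.
rewrite bl' lee_fin chain_rcons; case: at_ => _ /eqP -> /=.
by lra.
Qed.

(** The upper bound is the Lipschitz estimate. For the lower bound, a nearly optimal partition of
    [[0, b]] is cut at [a]: its left part contributes at most [a], so its right part contributes
    almost [b - a]. *)
Lemma curve_sublength gamma a b : 0 <= a -> a <= b -> b <= curve_len gamma ->
  curve_length gamma a b = (b - a)%:E.
Proof.
move=> a0 ab bl; apply/eqP; rewrite eq_le; apply/andP; split.
  rewrite curve_lengthE; apply: ge_ereal_sup => _ [t abt <-]; rewrite lee_fin.
  rewrite -[leRHS]mul1r.
  apply: (@chain_lipschitz _ _ _ _ _ _ _ `[a, b]%classic) abt => // x y.
  rewrite mul1r /= !in_itv/= => /andP[ax xb] /andP[ay yb] xy.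
  by apply: curve_lipschitz => //; [exact: le_trans ax|exact: le_trans bl].
move: ab; rewrite [a <= b]le_eqVlt => /predU1P[->|ab].
  rewrite subrr curve_lengthE; apply: ereal_sup_ubound; exists [::] => //.
have bl' : curve_length gamma 0 b = b%:E.
  by apply: curve_arc_length; rewrite in_itv/= bl (le_trans a0 (ltW ab)).
move: a0; rewrite [0 <= a]le_eqVlt => /predU1P[<-|a0]; first by rewrite bl' subr0.
apply/lee_addgt0Pr => e e0.
have [t bt bet] := curve_length_adherent bl' e0.
have := chain_split gamma (ltW a0) (proj1 bt).
have := chain_le_curve_length gamma (itv_partitionRP a0 ab bt).
have aL := chain_le_curve_length gamma (itv_partitionLP a0 ab bt).
rewrite curve_arc_length ?in_itv/= ?lee_fin ?(ltW a0) ?(le_trans (ltW ab))// in aL.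
move: (curve_length _ _ _) => [r| |]; last by rewrite leeNy_eq.
  by rewrite -EFinD !lee_fin in aL *; lra.
by move=> _ _; rewrite addye ?leey.
Qed.

(** Arc length is additive by [curve_sublength], so the translated restriction is again parametrized
    by arc length. *)
Lemma subcurve gamma a b : 0 <= a -> a < b -> b <= curve_len gamma ->
  exists2 gamma' : curve P, curve_len gamma' = b - a &
    forall t, gamma' t = gamma (a + t).
Proof.
move=> a0 ab bl; pose f t := gamma (a + t).
have l0 : 0 <= b - a by rewrite subr_ge0 ltW.
have lip x y : x \in `[0, b - a] -> y \in `[0, b - a] ->
    mdist (f x) (f y) <= `|x - y|.
  wlog xy : x y / x <= y => [H xI yI|].
    have [/ltW|] := ltP y x; last by move=> /H; exact.
    by move=> /H/(_ yI xI); rewrite distrC metric_sym.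
  rewrite !in_itv/= => /andP[x0 xb] /andP[y0 yb].
  rewrite distrC ger0_norm ?subr_ge0//.
  have -> : y - x = (a + y) - (a + x) by ring.
  by apply: curve_lipschitz; lra.
have fl t : t \in `[0, b - a] -> curve_length f 0 t = t%:E.
  rewrite in_itv/= => /andP[t0 tb].
  have -> : t%:E = curve_length gamma a (a + t).
    by rewrite curve_sublength; [congr EFin; ring|lra..].
  rewrite !curve_lengthE; congr ereal_sup; apply/seteqP; split.
    move=> _ [s ts <-]; exists (map (+%R a) s).
      by rewrite -[a in itv_partition a](addr0 a); exact: itv_partition_shift.
    by rewrite -{1}(addr0 a) -chain_comp.
  move=> _ [s ts <-]; exists (map (+%R (- a)) s).
    by rewrite -(addKr a t) -[X in itv_partition X](addNr a); exact: itv_partition_shift.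
  rewrite (@chain_comp _ _ _ gamma (+%R a)) addr0 -map_comp.
  by rewrite (@eq_map _ _ _ id) ?map_id// => y /=; rewrite addNKr.
have fc : {within `[0, b - a], continuous f}.
  apply/subspace_continuousP => x xI; apply/cvg_ballP => e e0.
  rewrite near_withinE; near=> y => yI.
  rewrite ballEmdist/=; apply: le_lt_trans (lip _ _ xI yI) _.
  by near: y; apply: cvgr_dist_lt.
have nc : exists2 t, t \in `[0, b - a] & f t <> f 0.
  (* If [f] were constant, all its chains would vanish, whereas its length is [b - a > 0]. *)
  apply: contrapT => fE; have fc0 t : t \in `[0, b - a] -> f t = f 0.
    by move=> tI; apply: contrapT => ft; apply: fE; exists t.
  have : ((b - a)%:E <= (0 : R)%:E)%E.
    rewrite -fl ?in_itv/= ?l0 ?lexx// curve_lengthE.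
    apply: ge_ereal_sup => _ [t abt <-].
    rewrite lee_fin -[leRHS](mul0r (b - a - 0)).
    apply: (@chain_lipschitz _ _ _ _ _ _ _ `[0, b - a]%classic) abt => // x y.
    by move=> /fc0-> /fc0-> _; rewrite mdistxx mul0r.
  by rewrite lee_fin leNgt subr_gt0 ab.
by exists (Curve l0 fc nc fl).
Unshelve. all: by end_near.
Qed.

End subcurves.

(** * Upper gradients along curves *)

Section lebesgue_translation.
Context (R : realType).
Notation lambda := (@lebesgue_measure R).
Local Open Scope ereal_scope.

Lemma measurable_shift (c : R) :
  measurable_fun [set: measurableTypeR R] (+%R c : _ -> measurableTypeR R).
Proof. by apply: measurable_funD; [exact: measurable_cst|exact: measurable_id]. Qed.

(** Both measures agree on half-open intervals, and these determine Lebesgue measure. *)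
Lemma lebesgue_measure_shift (c : R) (A : set R) : measurable A ->
  pushforward lambda (+%R c : _ -> measurableTypeR R) A = lambda A.
Proof.
pose F : {mfun measurableTypeR R >-> measurableTypeR R} :=
  HB.pack (+%R c : measurableTypeR R -> measurableTypeR R)
    (isMeasurableFun.Build _ _ _ _ _ (measurable_shift c)).
move=> mA; apply/esym.
apply: (@lebesgue_measure_unique _ (pushforward lambda F)) => //= _ [[a b]] _ <-.
rewrite /pushforward (_ : +%R c @^-1` _ = `](a - c)%R, (b - c)%R]%classic).
  rewrite !lebesgue_measure_itv/= !lte_fin ltrD2r.
  by case: ifPn => // _; rewrite -!EFinB; congr EFin; ring.
by apply/seteqP; split => x /=; rewrite !in_itv/= => /andP[? ?]; apply/andP; split; lra.
Qed.

Lemma ge0_integral_shift (c : R) (D : set R) (f : R -> \bar R) :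
  measurable D -> measurable_fun D f -> (forall x, D x -> 0 <= f x) ->
  \int[lambda]_(x in +%R c @^-1` D) f (c + x)%R = \int[lambda]_(x in D) f x.
Proof.
move=> mD mf f0.
pose F : {mfun measurableTypeR R >-> measurableTypeR R} :=
  HB.pack (+%R c : measurableTypeR R -> measurableTypeR R)
    (isMeasurableFun.Build _ _ _ _ _ (measurable_shift c)).
transitivity (\int[pushforward lambda F]_(x in D) f x).
  by rewrite ge0_integral_pushforward// => y /[1!inE]; exact: f0.
by apply: eq_measure_integral => A mA _; exact: lebesgue_measure_shift.
Qed.

End lebesgue_translation.

Section small_integral.
Local Open Scope ereal_scope.
Context d (T : measurableType d) (R : realType) (mu : {measure set T -> \bar R}).

(** Absolute continuity of the integral along sets shrinking to a null set: the complements exhaust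
    [D] up to that null set, so by monotone convergence they carry almost the whole finite
    integral. *)
Lemma ge0_integral_small (D : set T) (A : (set T)^nat) (f : T -> \bar R) :
  measurable D -> (forall n, measurable (A n)) -> (forall n, A n `<=` D) ->
  nonincreasing_seq A -> mu (\bigcap_n A n) = 0 ->
  measurable_fun D f -> (forall x, D x -> 0 <= f x) ->
  \int[mu]_(x in D) f x < +oo ->
  forall e : R, (0 < e)%R -> exists n, \int[mu]_(x in A n) f x < e%:E.
Proof.
move=> mD mA AD niA A0 mf f0 foo e e0.
have mDA n : measurable (D `\` A n) by exact: measurableD.
have mcap : measurable (\bigcap_n A n) by exact: bigcapT_measurable.
have cv : \int[mu]_(x in D `\` A n) f x @[n --> \oo] -->
    \int[mu]_(x in \bigcup_n (D `\` A n)) f x.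
  apply: ge0_nondecreasing_set_cvg_integral => //.
  - by move=> m n mn; rewrite subsetEset; apply: setDS; rewrite -subsetEset niA.
  - by move=> n; apply: measurable_funS mf => // x [].
  - by move=> n x [Dx _]; exact: f0.
have cupE : \bigcup_n (D `\` A n) = D `\` \bigcap_n A n.
  apply/seteqP; split => [x [n _ [Dx nA]]|x [Dx nA]].
    by split=> // /(_ n I).
  apply: contrapT => H; apply: nA => n _; apply: contrapT => nAn.
  by apply: H; exists n.
rewrite cupE in cv.
have IE : \int[mu]_(x in D) f x = \int[mu]_(x in D `\` \bigcap_n A n) f x.
  exact: ge0_negligible_integral.
rewrite -IE in cv.
have Ifin : \int[mu]_(x in D) f x \is a fin_num.
  by rewrite ge0_fin_numE// integral_ge0.
have split n : \int[mu]_(x in D) f x =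
    \int[mu]_(x in D `\` A n) f x + \int[mu]_(x in A n) f x.
  rewrite -ge0_integral_setU//.
  - by rewrite setUC setDUK.
  - by rewrite setUC setDUK.
  - by move=> x; rewrite setUC setDUK//; exact: f0.
  - by apply/disj_setPS => x [[]].
have : \int[mu]_(x in D) f x - e%:E < \int[mu]_(x in D) f x.
  by rewrite lteBlDr// lteDl// lte_fin.
move=> /open_ereal_gt' /cv [n _ /(_ n (leqnn n))] /=.
rewrite [X in X + _ < _](split n).
have : \int[mu]_(x in D `\` A n) f x + \int[mu]_(x in A n) f x \is a fin_num.
  by rewrite -split.
rewrite fin_numD => /andP[].
move: (\int[mu]_(x in D `\` A n) f x) => [r| |]// _.
case As : (\int[mu]_(x in A n) f x) => [s| |]// _.
rewrite -!EFinD !lte_fin => H; exists n.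
by rewrite As lte_fin; lra.
Qed.

End small_integral.

Section curves_and_upper_gradients.
Context (R : realType) (d : measure_display) (P : metricMeasurableType d R).
Notation lambda := (@lebesgue_measure R).
Local Open Scope ereal_scope.
Implicit Types (gamma : curve P) (h u : P -> \bar R).

Lemma abse_distC (x y : \bar R) : `|x - y| = `|y - x|.
Proof. by case: x y => [r| |] [s| |] //=; rewrite distrC. Qed.

Lemma borel_open (U : set P) : open U -> borel_set U.
Proof. exact: sub_sigma_algebra. Qed.

Lemma open_ball_metric (x : P) (r : R) : open (ball x r).
Proof.
rewrite openE => y; rewrite ballEmdist/= => xyr; rewrite /interior.
apply/nbhs_ballP; exists (r - mdist x y)%R; first by rewrite /= subr_gt0.
move=> z; rewrite !ballEmdist/= ltrBrDl; apply: le_lt_trans.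
exact: metric_triangle.
Qed.

Lemma curve_len_gt0 gamma : (0 < curve_len gamma)%R.
Proof.
have [t + gt] := curve_nonconstant gamma; rewrite in_itv/= => /andP[t0 tl].
apply: lt_le_trans tl; rewrite lt_neqAle t0 andbT; apply/negP => /eqP t0E.
by apply: gt; rewrite -t0E.
Qed.

Lemma curve_preimage_open gamma (U : set P) : open U ->
  measurable (`[0%R, curve_len gamma] `&` (gamma @^-1` U) : set R).
Proof.
move=> oU; apply: (@open_measurable_subspace R `[0%R, curve_len gamma]%classic).
  exact: measurable_itv.
by have /continuousP := @curve_continuous _ _ _ gamma; apply.
Qed.

Lemma measurable_curve gamma :
  measurable_fun `[0%R, curve_len gamma]%classic
    (gamma : measurableTypeR R -> g_sigma_algebraType (@open P)).
Proof.
apply: (@measurability _ _ (measurableTypeR R) (g_sigma_algebraType (@open P))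
  _ _ (@open P : set (set (g_sigma_algebraType (@open P))))) => //.
by move=> _ [U oU <-]; exact: curve_preimage_open.
Qed.

Lemma measurable_comp_curve gamma h : borel_fun h ->
  measurable_fun (`[0%R, curve_len gamma]%classic : set (measurableTypeR R))
    (h \o gamma).
Proof.
move=> bh; exact: (@measurableT_comp _ _ _ (measurableTypeR R)
  (g_sigma_algebraType (@open P)) _ h _ gamma bh (@measurable_curve gamma)).
Qed.

Lemma upper_gradient_subcurve gamma h u (a b : R) : upper_gradient h u ->
  (0 <= a)%R -> (a < b)%R -> (b <= curve_len gamma)%R ->
  `|u (gamma a) - u (gamma b)| <= \int[lambda]_(t in `[a, b]) h (gamma t).
Proof.
move=> [bh h0 hu] a0 ab bl.
have [gamma' lE gE] := subcurve a0 ab bl.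
have := hu gamma'; rewrite /upper_gradient_along /line_integral lE !gE addr0 subrKC.
move=> /le_trans; apply.
rewrite -(@ge0_integral_shift _ a `[a, b]%classic (h \o gamma))//.
- rewrite (_ : +%R a @^-1` _ = `[0%R, (b - a)%R]%classic).
    by under eq_integral do rewrite gE.
  by apply/seteqP; split => x /=; rewrite !in_itv/= => /andP[? ?]; apply/andP; split; lra.
- apply: measurable_funS (@measurable_comp_curve gamma h bh) => //.
  by move=> x /=; rewrite !in_itv/= => /andP[? ?]; apply/andP; split; lra.
- by move=> x _; exact: h0.
Qed.

(* For [t = z] the claim says that [u (gamma z)] is finite, since
   [`|oo - oo| = oo]. *)
Lemma upper_gradient_continuous gamma h u (z e : R) : upper_gradient h u ->
  line_integral gamma h < +oo -> z \in `[0%R, curve_len gamma] -> (0 < e)%R ->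
  exists2 del : R, (0 < del)%R & forall t, t \in `[0%R, curve_len gamma] ->
    (`|z - t| <= del)%R -> `|u (gamma z) - u (gamma t)| < e%:E.
Proof.
set l := curve_len gamma => ug hoo zI e0.
have l0 : (0 < l)%R := curve_len_gt0 gamma.
have [bh h0 _] := ug.
(* Windows shrinking to the single parameter [z]. The subcurve between [z] and any [t] in a window
   stays in it, so a small integral over the window controls the variation of [u]. *)
pose A n : set R := `[0%R, l]%classic `&`
  `[(z - l / n.+1%:R)%R, (z + l / n.+1%:R)%R]%classic.
have mA n : measurable (A n) by apply: measurableI; exact: measurable_itv.
have [||||||n An] := @ge0_integral_small _ _ _ lambda `[0%R, l]%classic A
  (h \o gamma) _ mA _ _ _ _ _ hoo e e0.
- exact: measurable_itv.
- by move=> n x [].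
- move=> m n mn; rewrite subsetEset => t [tI]; split => //.
  move: b; rewrite /= !in_itv/= => /andP[t1 t2].
  have : (l / n.+1%:R <= l / m.+1%:R)%R.
    by rewrite ler_pM2l// lef_pV2 ?posrE// ler_nat.
  move: (l / n.+1%:R)%R (l / m.+1%:R)%R t1 t2 => p q ? ? ?.
  by apply/andP; split; lra.
- apply/eqP; rewrite eq_le measure_ge0 andbT.
  rewrite -(lebesgue_measure_set1 z); apply: le_measure; rewrite ?inE//.
    exact: bigcapT_measurable.
  move=> t tA; apply/eqP; rewrite -subr_eq0 -normr_le0.
  apply/ler_addgt0Pr => k k0; rewrite add0r.
  have [n nk] : exists n, (l / k < n.+1%:R)%R.
    exists (Num.trunc (l / k)); exact: truncnS_gt.
  have := tA n I; rewrite /A/= => -[_]; rewrite in_itv/= => tn.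
  have : (l / n.+1%:R <= k)%R.
    by rewrite ler_pdivrMr// mulrC -ler_pdivrMr// ltW.
  move: (l / n.+1%:R)%R tn => p /andP[? ?] ?.
  by rewrite ler_norml; apply/andP; split; lra.
- exact: measurable_comp_curve.
- by move=> x _; exact: h0.
pose del := (l / n.+1%:R)%R.
have del0 : (0 < del)%R by rewrite divr_gt0.
rewrite /A -/del in An.
have near t : t \in `[0%R, l] -> (`|z - t| <= del)%R -> z != t ->
    `|u (gamma z) - u (gamma t)| < e%:E.
  move=> tI; rewrite ler_norml => ztd zt.
  apply: le_lt_trans An.
  have sub a b : (0 <= a)%R -> (b <= l)%R -> (z - del <= a)%R -> (b <= z + del)%R ->
      \int[lambda]_(x in `[a, b]) h (gamma x) <=
        \int[lambda]_(x in `[0%R, l]%classic `&` `[(z - del)%R, (z + del)%R]%classic)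
        (h \o gamma) x.
    move=> a0 bl az bz; apply: ge0_subset_integral => //.
    + by apply: measurableI; exact: measurable_itv.
    + exact: measurable_funS (@measurable_comp_curve gamma h bh).
    + move=> x; rewrite /= !in_itv/= => /andP[? ?].
      by split; apply/andP; split; lra.
  move: zI tI; rewrite !in_itv/= => zI tI.
  have [ztlt|tzlt|/eqP] := ltgtP z t; last by rewrite (negbTE zt).
  - apply: le_trans (upper_gradient_subcurve ug _ ztlt _) _; [lra|rewrite -/l; lra|].
    by apply: sub; lra.
  - rewrite abse_distC.
    apply: le_trans (upper_gradient_subcurve ug _ tzlt _) _; [lra|rewrite -/l; lra|].
    by apply: sub; lra.
exists del => // t tI ztd.
have [zt|] := eqVneq z t; last exact: near.
rewrite -zt.
(* A second parameter in the window, on the side of [z] where half the curve leaves room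
   ([del <= l]). The estimate there excludes an infinite [u (gamma z)], which would make the
   difference infinite. *)
have [t' [t'I zt' dt']] : exists t',
    [/\ t' \in `[0%R, l], z != t' & (`|z - t'| <= del)%R].
  move: zI; rewrite in_itv/= => zI.
  have dell : (del <= l)%R by rewrite ler_pdivrMr// ler_peMr ?ler1n ?ltW.
  have [zl|zl] := leP z (l / 2)%R.
  - exists (z + del / 2)%R; rewrite in_itv/=; split.
    + by apply/andP; split; lra.
    + by rewrite lt_eqF//; lra.
    + by rewrite ler_norml; apply/andP; split; lra.
  - exists (z - del / 2)%R; rewrite in_itv/=; split.
    + by apply/andP; split; lra.
    + by rewrite gt_eqF//; lra.
    + by rewrite ler_norml; apply/andP; split; lra.
have := near _ t'I dt' zt'.
case: (u (gamma z)) (u (gamma t')) => [r| |] [v| |] //=.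
by rewrite subrr normr0 !lte_fin.
Qed.

End curves_and_upper_gradients.

(** * Capacity of null superlevel sets *)

Section null_sets_have_zero_capacity.
Context (R : realType) (d : measure_display) (P : metricMeasurableType d R).
Variable mu : {measure set P -> \bar R}.
Variables (cD : R) (N : (P -> \bar R) -> \bar R).
Hypothesis hP : metric_measure_space mu.
Hypothesis hX : quasi_Banach_function_lattice mu cD N.
Notation lambda := (@lebesgue_measure R).
Local Open Scope ereal_scope.

Lemma borel_fun_measurable (h : P -> \bar R) :
  borel_fun h -> measurable_fun [set: P] h.
Proof.
move=> bh _ Y mY; rewrite setTI; apply: (mms_borel hP).
by have := bh measurableT Y mY; rewrite setTI.
Qed.

Lemma borel_fun_addy (h : P -> \bar R) (E : set P) :
  borel_fun h -> borel_set E -> borel_fun (h \+ (cst +oo) \_ E).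
Proof.
move=> bh bE; apply: (@emeasurable_funD _ (g_sigma_algebraType (@open P))) => //.
exact: (@measurable_restrictT _ _ (g_sigma_algebraType (@open P)) _ E (cst +oo) bE).1.
Qed.

Lemma leDl_addy (h : P -> \bar R) (E : set P) (y : P) :
  h y <= (h \+ (cst +oo) \_ E) y.
Proof. by rewrite /= patchE; case: ifPn => _; rewrite leeDl// leey. Qed.

Lemma measurable_ball_metric (x : P) (r : R) : measurable (ball x r).
Proof. by apply: (mms_borel hP); apply: borel_open; exact: open_ball_metric. Qed.

Variables (u h : P -> \bar R) (x : P) (r m a : R).
Hypotheses (mu_u : measurable_fun [set: P] u) (ug : upper_gradient h u).
Hypothesis Nh : N h < +oo.

Let E := [set y | ball x r y /\ a%:E < `|u y - m%:E|].

(** Both conditions defining [E] are open along a curve on which [h] is integrable: the first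
    because the curve is 1-Lipschitz, the second because [u] is continuous along it. *)
Lemma superlevel_stable_along (gamma : curve P) (z : R) :
  line_integral gamma h < +oo -> z \in `[0%R, curve_len gamma] ->
  E (gamma z) -> exists2 del : R, (0 < del)%R &
    forall t, t \in `[0%R, curve_len gamma] -> (`|z - t| <= del)%R ->
      E (gamma t).
Proof.
move=> hoo zI [Bz az].
(* Used only at [t = z], to see that [u (gamma z)] is finite; the tolerance 1 is arbitrary. *)
have [del1 del10 H1] := upper_gradient_continuous ug hoo zI ltr01.
have uz : u (gamma z) \is a fin_num.
  have := H1 z zI; rewrite subrr normr0 => /(_ (ltW del10)).
  by case: (u (gamma z)).
move: uz az H1; case E1 : (u (gamma z)) => [uz| |]//= _.
rewrite lte_fin => az _.
have e0 : (0 < `|uz - m| - a)%R by rewrite subr_gt0.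
have [del2 del20 H2] := upper_gradient_continuous ug hoo zI e0.
move: Bz; rewrite ballEmdist/= => Bz.
pose del3 := ((r - mdist x (gamma z)) / 2)%R.
have del30 : (0 < del3)%R by rewrite divr_gt0// subr_gt0.
exists (Num.min del2 del3); first by rewrite lt_min del20.
move=> t tI; rewrite le_min => /andP[t2 t3]; split.
  rewrite ballEmdist/=; apply: le_lt_trans (metric_triangle _ (gamma z) _) _.
  have : (mdist (gamma z) (gamma t) <= `|z - t|)%R.
    move: zI tI; rewrite !in_itv/= => /andP[z0 zl] /andP[t0 tl].
    have [zt|/ltW tz] := leP z t.
      by rewrite distrC ger0_norm ?subr_ge0//; exact: curve_lipschitz.
    by rewrite ger0_norm ?subr_ge0// metric_sym; exact: curve_lipschitz.
  by rewrite /del3 in t3 *; lra.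
have := H2 t tI t2; rewrite E1.
case: (u (gamma t)) => [v| |]//=; rewrite ?ltry// !lte_fin => H.
have := ler_normD (uz - v)%R (v - m)%R; rewrite subrKA.
by lra.
Qed.

Lemma line_integral_through_null_set (E' : set P) (gamma : curve P) (z : R) :
  borel_set E' -> E `<=` E' -> z \in `[0%R, curve_len gamma] ->
  E (gamma z) -> line_integral gamma (h \+ (cst +oo) \_ E') = +oo.
Proof.
move=> bE' EE' zI Ez.
set l := curve_len gamma; set rho := h \+ _.
have l0 : (0 < l)%R := curve_len_gt0 gamma.
have [bh h0 _] := ug.
have brho : borel_fun rho := borel_fun_addy bh bE'.
have rho0 y : 0 <= rho y := le_trans (h0 y) (leDl_addy h E' y).
have [hoo|] := ltP (line_integral gamma h) +oo; last first.
  rewrite leye_eq => /eqP hoo; apply/eqP; rewrite -leye_eq -hoo.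
  apply: ge0_le_integral => //.
  - exact: measurable_comp_curve.
  - exact: measurable_comp_curve.
  - by move=> t _; exact: leDl_addy.
have [del del0 H] := superlevel_stable_along hoo zI Ez.
(* The window around [z] cut down to the parameter interval. It has positive length even when [z] is
   an end point, and the curve stays in [E], where the added term is infinite. *)
pose b1 := Num.max 0%R (z - del)%R; pose b2 := Num.min l (z + del)%R.
have b12 : (b1 < b2)%R.
  move: zI; rewrite in_itv/= -/l => /andP[z0 zl].
  by rewrite /b1 /b2 gt_max !lt_min; apply/andP; split; apply/andP; split; lra.
apply/eqP; rewrite -leye_eq.
apply: (@le_trans _ _ (\int[lambda]_(t in `[b1, b2]) rho (gamma t))); last first.
  apply: ge0_subset_integral => //.
  - exact: measurable_comp_curve.
  - move=> t /=; rewrite !in_itv/= /b1 /b2 ge_max le_min.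
    by move=> /andP[/andP[-> _] /andP[-> _]].
rewrite (@eq_integral _ _ _ lambda _ (cst +oo)); last first.
  move=> t /[1!inE] /=; rewrite in_itv/= /b1 /b2 ge_max le_min.
  move=> /andP[/andP[t0 zt] /andP[tl tz]].
  have Et : E (gamma t).
    apply: H; first by rewrite in_itv/= t0.
    by rewrite ler_norml; apply/andP; split; lra.
  rewrite /rho /= patchE mem_set; last exact: EE'.
  by rewrite addey//; have := h0 (gamma t); case: (h _).
rewrite integral_cst/=; last exact: measurable_itv.
by rewrite lebesgue_measure_itv/= lte_fin b12 gt0_mulye// lte_fin subr_gt0.
Qed.

Lemma capacity_ge0 (F : set P) : 0 <= capacity N F.
Proof.
apply: le_ereal_inf_tmp => _ [v [mv _] <-].
rewrite /newtonian_norm adde_ge0 ?(qbfl_ge0 hX)//.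
apply: le_ereal_inf_tmp => _ [g [bg _ _] <-].
by rewrite (qbfl_ge0 hX)//; exact: borel_fun_measurable.
Qed.

(** The indicator of [E] has norm 0 and [N rho <= N h], so the upper gradients [k * rho] bound the
    capacity by [k * N h] for every [k > 0]. For a curve with neither end point in [E] the gradient
    inequality is trivial. *)
Lemma capacity_superlevel_null : mu E = 0 -> capacity N E = 0.
Proof.
move=> E0; have [bh h0 _] := ug.
have mE : measurable E.
  rewrite (_ : E = ball x r `&` [set y | a%:E < `|u y - m%:E|])//.
  apply: emeasurable_fun_o_infty; first exact: measurable_ball_metric.
  apply: measurableT_comp => //; apply: emeasurable_funB => //.
  exact: measurable_funTS.
have [E' [bE' EE' mE'0]] := mms_regular hP mE.
rewrite E0 in mE'0.
pose rho := h \+ (cst +oo) \_ E'.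
have brho : borel_fun rho := borel_fun_addy bh bE'.
have rho0 y : 0 <= rho y := le_trans (h0 y) (leDl_addy h E' y).
have mrho := borel_fun_measurable brho.
have mh := borel_fun_measurable bh.
have Nrho : N rho <= N h.
  apply: (qbfl_lattice hX) => //.
  exists E'; split => //; first exact: (mms_borel hP).
  move=> y; apply: contraPP => nE'.
  by rewrite /rho /= patchE memNset// adde0; apply.
have N1 : N (EFin \o \1_E) = 0.
  apply/(qbfl_eq0 hX); first exact/measurable_EFinP/measurable_indic.
  exists E; split => // y; apply: contraPP => nE.
  by rewrite /= indicE memNset//; apply.
have ub (k : R) : (0 < k)%R -> capacity N E <= k%:E * N h.
  move=> k0.
  apply: (@le_trans _ _ (newtonian_norm N (EFin \o \1_E))).
    apply: ereal_inf_lbound; exists (EFin \o \1_E) => //; split.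
      exact/measurable_EFinP/measurable_indic.
    by move=> y Ey; rewrite /= indicE mem_set.
  rewrite /newtonian_norm N1 add0e.
  apply: (@le_trans _ _ (N (fun y => k%:E * rho y))); last first.
    rewrite (qbfl_homogeneous hX)// gtr0_norm//.
    by apply: lee_wpmul2l; rewrite // lee_fin ltW.
  apply: ereal_inf_lbound; exists (fun y => k%:E * rho y) => //; split.
  - exact: measurable_funeM.
  - by move=> y; rewrite mule_ge0// lee_fin ltW.
  - move=> gamma; rewrite /upper_gradient_along.
    have I0 : 0%R \in `[0%R, curve_len gamma].
      by rewrite in_itv/= lexx ltW// curve_len_gt0.
    have Il : curve_len gamma \in `[0%R, curve_len gamma].
      by rewrite in_itv/= lexx andbT ltW// curve_len_gt0.
    have Loo : line_integral gamma rho = +oo ->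
        line_integral gamma (fun y => k%:E * rho y) = +oo.
      move=> H; rewrite /line_integral ge0_integralZl//.
      + by rewrite [X in _ * X]H gt0_muley// lte_fin.
      + exact: measurable_comp_curve.
      + by rewrite lee_fin ltW.
    have [E00|E00] := pselect (E (gamma 0%R)).
      by rewrite Loo ?leey//; exact: line_integral_through_null_set E00.
    have [E01|E01] := pselect (E (gamma (curve_len gamma))).
      by rewrite Loo ?leey//; exact: line_integral_through_null_set E01.
    rewrite /= !indicE !memNset//= subrr normr0.
    by apply: integral_ge0 => t _; rewrite mule_ge0// lee_fin ltW.
apply/eqP; rewrite eq_le capacity_ge0 andbT.
have Nh0 : 0 <= N h by rewrite (qbfl_ge0 hX).
move: Nh Nh0 ub; case: (N h) => [n| |]// _; rewrite lee_fin => n0 ub.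
apply/lee_addgt0Pr => e e0; rewrite add0e.
(* Here [n] is the value of [N h]; adding 1 avoids a division by 0 and still gives [k * n <= e]. *)
have k0 : (0 < e / (n + 1))%R by rewrite divr_gt0// ltr_wpDl.
apply: le_trans (ub _ k0) _; rewrite -EFinM lee_fin.
rewrite -mulrA mulrC; apply: ler_piMl; first exact: ltW.
by rewrite mulrC ler_pdivrMr ?mul1r ?lerDl ?ltr_wpDl.
Qed.

End null_sets_have_zero_capacity.

(** * From weak upper gradients to Borel upper gradients *)

(** Monotonicity without measurability, immediate from the supremum over simple functions. It serves
    line integrals of a weak upper gradient, whose composition with a curve need not be
    measurable. *)
Lemma le_integral_ge0 d (T : measurableType d) (R : realType)
    (mu : {measure set T -> \bar R}) (D : set T) (f g : T -> \bar R) :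
  (forall x, D x -> 0 <= f x)%E -> (forall x, D x -> f x <= g x)%E ->
  (\int[mu]_(x in D) f x <= \int[mu]_(x in D) g x)%E.
Proof.
move=> f0 fg; have g0 x : D x -> (0 <= g x)%E.
  by move=> Dx; exact: le_trans (f0 _ Dx) (fg _ Dx).
rewrite !ge0_integralE//; apply: ge_ereal_sup => _ [k kf <-].
apply: ereal_sup_ubound; exists k => // x; apply: le_trans (kf x) _.
by rewrite !patchE; case: ifPn => //; rewrite inE; exact: fg.
Qed.

Section borel_upper_gradients.
Context (R : realType) (d : measure_display) (P : metricMeasurableType d R).
Variable mu : {measure set P -> \bar R}.
Variables (cD : R) (N : (P -> \bar R) -> \bar R).
Hypothesis hP : metric_measure_space mu.
Hypothesis hX : quasi_Banach_function_lattice mu cD N.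
Local Open Scope ereal_scope.

Lemma le_ereal_rat (y s : \bar R) :
  (forall q : rat, (ratr q)%:E < y -> (ratr q)%:E <= s) -> y <= s.
Proof.
move=> H; rewrite leNgt; apply/negP => sy.
suff [q sq qy] : exists2 q : rat, s < (ratr q)%:E & (ratr q)%:E < y.
  by have := le_lt_trans (H q qy) sq; rewrite ltxx.
case: s y sy {H} => [s| |] [y| |]//.
- rewrite lte_fin => /rat_in_itvoo[q]; rewrite in_itv/= => /andP[? ?].
  by exists q; rewrite lte_fin.
- move=> _; have /rat_in_itvoo[q] : (s < s + 1)%R by rewrite ltrDl.
  by rewrite in_itv/= => /andP[? ?]; exists q; rewrite ?lte_fin// ltry.
- move=> _; have /rat_in_itvoo[q] : (y - 1 < y)%R by rewrite ltrBlDr ltrDl.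
  by rewrite in_itv/= => /andP[? ?]; exists q; rewrite ?lte_fin// ltNyr.
- by move=> _; exists 0%R; rewrite ?ltry ?ltNyr.
Qed.

(** Each superlevel set of [g] at a rational level, cut to a piece of finite measure, is enlarged to
    a Borel set [D k] of the same measure. The majorant is the supremum over [k] of the functions
    equal to the level on [D k] and to 0 elsewhere. *)
Lemma borel_majorant (g : P -> \bar R) : measurable_fun [set: P] g ->
  (forall y, 0 <= g y) -> exists g', [/\ borel_fun g', forall y, g y <= g' y &
    {ae mu, forall y, g' y = g y}].
Proof.
move=> mg g0; have [F FT mF] := mms_sigma_finite hP.
pose qn k : rat * nat := odflt (0%R, 0%N) (unpickle k).
pose A k := [set y | (ratr (qn k).1)%:E < g y] `&` F (qn k).2.
have mA k : measurable (A k).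
  apply: measurableI; last by have [] := mF (qn k).2.
  by rewrite -[X in measurable X]setTI; exact: emeasurable_fun_o_infty.
have [D DP] := choice (fun k => mms_regular hP (mA k)).
pose f k := (cst (ratr (qn k).1)%:E : P -> \bar R) \_ (D k).
exists (fun y => esups (f ^~ y) 0%N); split.
- apply: (@measurable_fun_esups _ (g_sigma_algebraType (@open P)) R) => k.
  have [bD _ _] := DP k.
  exact: (@measurable_restrictT _ _ (g_sigma_algebraType (@open P)) _ (D k)
    (cst (ratr (qn k).1)%:E) bD).1.
- move=> y; apply: le_ereal_rat => q qy.
  have [n _ Fy] : (\bigcup_n F n) y by rewrite -FT.
  apply: ereal_sup_ubound; exists (pickle (q, n)) => //.
  have [_ AD _] := DP (pickle (q, n)).
  rewrite /f patchE mem_set ?/qn ?pickleK//.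
  by apply: AD; rewrite /A /qn pickleK.
- apply: (@negligibleS _ _ _ mu (\bigcup_k (D k `\` A k))); last first.
    apply: negligible_bigcup => k; have [bD AD DA] := DP k.
    exists (D k `\` A k); split => //.
      by apply: measurableD => //; exact: (mms_borel hP).
    have mD := mms_borel hP bD.
    (* Finiteness is what turns equality of measures into a null difference [D k \ A k]. *)
    have Afin : mu (A k) < +oo.
      have [mFk Foo] := mF (qn k).2; apply: le_lt_trans Foo.
      by apply: le_measure; rewrite ?inE// => ? [].
    have Dfin : mu (D k) < +oo by rewrite DA.
    have kA := mA k.
    transitivity (mu (D k) - mu (D k `&` A k)); first exact: measureD.
    by rewrite (setIidr AD) DA subee// ge0_fin_numE.
  move=> y; apply: contraPP => nZ; apply; apply/eqP; rewrite eq_le.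
  apply/andP; split.
    apply: ge_ereal_sup => _ [k _ <-]; rewrite /f patchE.
    case: ifPn => [|_]; last exact: g0.
    rewrite inE => Dy; apply: ltW; have : A k y; last by case.
    by apply: contrapT => nA; apply: nZ; exists k.
  apply: le_ereal_rat => q qy.
  have [n _ Fy] : (\bigcup_n F n) y by rewrite -FT.
  apply: ereal_sup_ubound; exists (pickle (q, n)) => //.
  have [_ AD _] := DP (pickle (q, n)).
  rewrite /f patchE mem_set ?/qn ?pickleK//.
  by apply: AD; rewrite /A /qn pickleK.
Qed.

(** A single [rho] serves every [e], so the contribution of [e * rho] to the norm can later be sent
    to 0. *)
Lemma weak_upper_gradient_approx (g u : P -> \bar R) :
  weak_upper_gradient N g u -> exists g' rho : P -> \bar R,
  [/\ measurable_fun [set: P] g', {ae mu, forall y, g' y = g y}, in_lattice N rho &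
    forall e : R, (0 < e)%R -> upper_gradient (fun y => g' y + e%:E * rho y) u].
Proof.
move=> [mg g0 [Gamma [rho [brho rho0 lrho rhoG]] uG]].
have [g' [bg' gg' g'g]] := borel_majorant mg g0.
have g'0 y : 0 <= g' y := le_trans (g0 y) (gg' y).
exists g', rho; split => //; first exact: (borel_fun_measurable hP).
move=> e e0; have e0' : 0 <= e%:E by rewrite lee_fin ltW.
have erho0 y : 0 <= e%:E * rho y by rewrite mule_ge0.
have berho : borel_fun (fun y => e%:E * rho y).
  exact: (@measurable_funeM _ (g_sigma_algebraType (@open P))).
split.
- exact: (@emeasurable_funD _ (g_sigma_algebraType (@open P))).
- by move=> y; rewrite adde_ge0.
- move=> gamma; rewrite /upper_gradient_along.
  have [Gg|/uG] := pselect (Gamma gamma).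
    suff -> : line_integral gamma (fun y => g' y + e%:E * rho y) = +oo by rewrite leey.
    apply/eqP; rewrite -leye_eq.
    apply: (@le_trans _ _ (line_integral gamma (fun y => e%:E * rho y))).
      rewrite /line_integral ge0_integralZl//.
        by rewrite [X in _ * X](rhoG _ Gg) gt0_muley// lte_fin.
      exact: measurable_comp_curve.
    by apply: le_integral_ge0 => t _ //; rewrite leeDr.
  move=> /le_trans; apply; rewrite /line_integral.
  apply: le_integral_ge0 => t _ //.
  by rewrite (le_trans (gg' _))// leeDl.
Qed.

End borel_upper_gradients.

(** * Oscillation on balls *)

Lemma powRV (R : realType) (a x : R) : 0 <= a -> a^-1 `^ x = (a `^ x)^-1.
Proof.
by move=> a0; rewrite -[a^-1]powR_inv1// powRAC powR_inv1// powR_ge0.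
Qed.

Section averages_on_balls.
Context (R : realType) (d : measure_display) (P : metricMeasurableType d R).
Variable mu : {measure set P -> \bar R}.
Hypothesis hP : metric_measure_space mu.
Implicit Types (x y z : P) (r t : R) (u h : P -> \bar R).

(** For positive radii [fine] loses nothing here, as balls have finite positive measure; likewise in
    [avg] for integrable [u]. *)
Definition vol x r : R := fine (mu (ball x r)).

Definition avg u x r : R := fine (mean mu (ball x r) u).

Local Notation mball := (measurable_ball_metric hP).

Lemma vol_gt0 x r : 0 < r -> 0 < vol x r.
Proof.
move=> r0; have /andP[m0 moo] := mms_ball hP x r0.
by rewrite /vol fine_gt0// m0.
Qed.

Lemma volE x r : 0 < r -> mu (ball x r) = (vol x r)%:E.
Proof.
move=> r0; have /andP[m0 moo] := mms_ball hP x r0.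
by rewrite /vol fineK// ge0_fin_numE// ltW.
Qed.

Lemma ball_sub x y r t : mdist x y + r <= t -> ball y r `<=` ball x t.
Proof.
move=> xyt z; rewrite !ballEmdist/= => yz; apply: lt_le_trans xyt.
by apply: le_lt_trans (metric_triangle x y z) _; rewrite ltrD2l.
Qed.

Local Open Scope ereal_scope.

Lemma inveV x r : (0 < r)%R -> (mu (ball x r))^-1 = ((vol x r)^-1)%:E.
Proof. by move=> r0; rewrite volE// inver gt_eqF// vol_gt0. Qed.

Lemma meanE x r u : (0 < r)%R ->
  mean mu (ball x r) u = (vol x r)^-1%:E * \int[mu]_(y in ball x r) u y.
Proof. by move=> r0; rewrite /mean inveV// muleC. Qed.

Lemma mean_fin x r u : (0 < r)%R -> mu.-integrable (ball x r) u ->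
  mean mu (ball x r) u = (avg u x r)%:E.
Proof.
move=> r0 iu; rewrite /avg fineK// meanE// fin_numM//.
by apply: integrable_fin_num => //; exact: mball.
Qed.

Lemma int_avg x r u : (0 < r)%R -> mu.-integrable (ball x r) u ->
  \int[mu]_(y in ball x r) u y = (vol x r * avg u x r)%:E.
Proof.
move=> r0 iu; rewrite EFinM -mean_fin// meanE// muleA -EFinM.
by rewrite divff ?mul1e// gt_eqF// vol_gt0.
Qed.

(** The integral of [|u - m|] over the small ball is at most that over the large one; dividing by
    the smaller volume costs the ratio of volumes. *)
Lemma avg_dist_le x r z t u (m k : R) : (0 < r)%R -> (0 < t)%R ->
  ball z t `<=` ball x r -> mu.-integrable (ball x r) u ->
  \int[mu]_(y in ball x r) `|u y - m%:E| <= (vol x r * k)%:E ->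
  (`|avg u z t - m| <= vol x r / vol z t * k)%R.
Proof.
move=> r0 t0 zx iu H.
have V0 := vol_gt0 z t0.
rewrite mulrAC ler_pdivlMr// -lee_fin; apply: le_trans H.
have iz : mu.-integrable (ball z t) u by apply: integrableS iu => //; exact: mball.
have ic : mu.-integrable (ball z t) (cst m%:E).
  apply/integrableP; split => //.
  rewrite (@integral_cst _ _ _ mu _ (mball z t) `|m|%:E) volE//.
  by rewrite -EFinM ltry.
have -> : (`|avg u z t - m| * vol z t)%:E =
    `| \int[mu]_(y in ball z t) (u y - m%:E) |.
  rewrite integralB//; last exact: mball.
  rewrite integral_cst//; last exact: mball.
  rewrite volE// int_avg// -EFinM -EFinB abse_EFin; congr EFin.
  by rewrite [(vol z t * _)%R]mulrC -mulrBl normrM (gtr0_norm V0).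
have mz : measurable_fun (ball z t) (fun y => u y - m%:E).
  by apply: emeasurable_funB => //; exact: measurable_int iz.
apply: le_trans (le_abse_integral mu (mball z t) mz) _.
apply: ge0_subset_integral => //; [exact: mball|exact: mball|].
apply: measurableT_comp => //; apply: emeasurable_funB => //.
exact: measurable_int iu.
Qed.

Lemma diam_ball x r : (0 < r)%R -> diam (ball x r) <= (2 * r)%:E.
Proof.
move=> r0; apply: ge_ereal_sup => _ [y + [z + <-]]; rewrite !ballEmdist/= => xy xz.
rewrite lee_fin; have := metric_triangle y x z; rewrite metric_sym.
by rewrite [mdist y x]metric_sym; lra.
Qed.

Lemma diam_ge0 (A : set P) x : A x -> 0 <= diam A.
Proof.
move=> Ax; apply: ereal_sup_ubound; exists x => //; exists x => //.
by rewrite mdistxx.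
Qed.

(** The integral in the Poincare inequality is enlarged to a fixed ball [ball z t], so that one
    bound [J] serves all smaller balls; only the normalizing volume still depends on the ball. *)
Lemma oscillation_le (cPI p lam : R) x r z t u h (J : R) :
  (0 < cPI)%R -> (0 < p)%R -> (0 < r)%R -> (1 <= lam)%R -> (0 < t)%R ->
  (mean mu (ball x r) (fun y => `|u y - mean mu (ball x r) u|) <=
    cPI%:E * diam (ball x r) *
      (mean mu (ball x (lam * r)) (fun y => h y `^ p)) `^ p^-1) ->
  ball x (lam * r) `<=` ball z t ->
  L1loc mu u -> measurable_fun [set: P] h ->
  (\int[mu]_(y in ball z t) (h y `^ p)) `^ p^-1 <= J%:E ->
  \int[mu]_(y in ball x r) `|u y - (avg u x r)%:E| <=
    (vol x r * (cPI * (2 * r) * (J / vol x (lam * r) `^ p^-1)))%:E.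
Proof.
move=> c0 p0 r0 lam1 t0 PI sub Lu mh HJ.
have V0 := vol_gt0 x r0.
have lr0 : (0 < lam * r)%R by rewrite mulr_gt0// (lt_le_trans ltr01).
have VL0 := vol_gt0 x lr0.
rewrite [X in _ <= X]EFinM -lee_pdivrMl//.
move: PI; rewrite (mean_fin r0 (Lu x r r0)) meanE//.
move=> /le_trans; apply; rewrite EFinM; apply: lee_pmul => //.
- by apply: mule_ge0; [rewrite lee_fin ltW|apply: (@diam_ge0 _ x); exact: ballxx].
- exact: poweR_ge0.
- by rewrite EFinM lee_pmul2l// diam_ball.
have hp0 : forall y, 0 <= h y `^ p by move=> y; exact: poweR_ge0.
rewrite meanE// poweRM ?integral_ge0//; last by rewrite lee_fin invr_ge0 ltW.
rewrite [(J / _)%R]mulrC EFinM; apply: lee_pmul; rewrite ?poweR_ge0//.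
  by rewrite poweR_EFin lee_fin powRV// ltW.
apply: le_trans HJ; apply: gt0_ler_poweR.
- by rewrite invr_ge0 ltW.
- by rewrite in_itv/= leey andbT integral_ge0.
- by rewrite in_itv/= leey andbT integral_ge0.
apply: ge0_subset_integral => //; [exact: mball|exact: mball|].
apply: measurable_funTS; exact: (measurableT_comp (measurable_poweR _)).
Qed.

End averages_on_balls.

(** * Telescoping averages over dyadic radii *)

Section chaining.
Context (R : realType) (d : measure_display) (P : metricMeasurableType d R).
Variable mu : {measure set P -> \bar R}.
Hypothesis hP : metric_measure_space mu.
Local Notation mball := (measurable_ball_metric hP).
Local Notation vol := (vol mu).
Local Notation avg := (avg mu).
Variables (cdbl cs cPI p s lam : R).
Hypothesis hdbl : forall (x : P) (r : R), 0 < r ->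
  vol x (2 * r) <= cdbl * vol x r.
Hypothesis cs0 : 0 < cs.
Hypothesis hdim : forall (x y : P) (r R0 : R), 0 < r -> r <= R0 ->
  ball x R0 y -> cs * (r / R0) `^ s <= vol y r / vol x R0.
Hypotheses (s0 : 0 < s) (sp : s < p) (lam1 : 1 <= lam).
Hypothesis cPI0 : 0 < cPI.
Hypothesis hPI : forall (x : P) (r : R), 0 < r -> forall u g : P -> \bar R,
  L1loc mu u -> upper_gradient g u ->
  (mean mu (ball x r) (fun y => `|u y - mean mu (ball x r) u|) <=
    cPI%:E * diam (ball x r) *
      (mean mu (ball x (lam * r)) (fun y => g y `^ p)) `^ p^-1)%E.

(* By the dimension condition, the [p]-th root of the measure of
   [B(y, lam r / 2 ^+ i)] is at least
   [cs `^ p^-1 * halfpow ^+ i.+1 * mu(B(x, 2 lam r)) `^ p^-1], so the mean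
   oscillation at scale [r / 2 ^+ i] decays like [chain_ratio ^+ i]. *)
Definition halfpow : R := 2^-1 `^ (s / p).
Definition chain_ratio : R := 2^-1 / halfpow.
Definition chain_const : R := 2 * cPI / (cs `^ p^-1 * halfpow).
(** The first summand pays for moving the center from [x] to [y] at radius [r], the second is the
    geometric series of the steps between successive radii. *)
Definition sup_const : R := 8 * cPI * (cs * 2^-1 `^ s)^-1 +
  cdbl * chain_const / (1 - chain_ratio).

Let p0 : 0 < p := lt_trans s0 sp.

Lemma halfpow_gt0 : 0 < halfpow. Proof. exact: powR_gt0. Qed.

Lemma chain_ratio_gt0 : 0 < chain_ratio.
Proof. by rewrite divr_gt0// halfpow_gt0. Qed.

(** The ratio is 2 to the power [s / p - 1], which is where [s < p] enters; the proof compares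
    logarithms. *)
Lemma chain_ratio_lt1 : chain_ratio < 1.
Proof.
rewrite ltr_pdivrMr ?halfpow_gt0// mul1r /halfpow /powR ifF; last first.
  by rewrite gt_eqF.
rewrite -[ltLHS](@lnK R 2^-1) ?posrE// ltr_expR.
rewrite ltr_nMl ?ltr_pdivrMr ?mul1r// -ln1 ltr_ln ?posrE//.
by rewrite invf_lt1// ltr1n.
Qed.

Lemma chain_const_gt0 : 0 < chain_const.
Proof. by rewrite divr_gt0 ?mulr_gt0 ?powR_gt0// halfpow_gt0. Qed.

Lemma sup_const_ge0 : 0 <= cdbl -> 0 <= sup_const.
Proof.
move=> cd0; rewrite /sup_const addr_ge0//.
  by rewrite !mulr_ge0 ?invr_ge0 ?mulr_ge0 ?powR_ge0 ?(ltW cs0) ?(ltW cPI0).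
apply: divr_ge0; last by rewrite subr_ge0 ltW// chain_ratio_lt1.
by rewrite mulr_ge0// ltW// chain_const_gt0.
Qed.

Variables (u h : P -> \bar R) (x : P) (r J : R).
Hypotheses (Lu : L1loc mu u) (ug : upper_gradient h u) (r0 : 0 < r).
Hypothesis hJ : ((\int[mu]_(y in ball x (2 * lam * r)) (h y `^ p)) `^ p^-1
  <= J%:E)%E.

Definition radius (i : nat) : R := r * 2^-1 ^+ i.
(** With [J] bounding an L^p norm over the ball of radius [2 * lam * r], the quantity [T] is [r]
    times the corresponding L^p average, the unit in which all oscillations are measured. *)
Let W := vol x (2 * lam * r) `^ p^-1.
Let T := r * J / W.

Let lam0 : 0 < lam := lt_le_trans ltr01 lam1.
Let lr0 : 0 < 2 * lam * r. Proof. by rewrite !mulr_gt0. Qed.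
Let J0 : 0 <= J.
Proof. by rewrite -lee_fin; apply: le_trans hJ; exact: poweR_ge0. Qed.
Let W0 : 0 < W. Proof. by rewrite powR_gt0// (vol_gt0 hP). Qed.
Let mh : measurable_fun [set: P] h.
Proof. by have [bh _ _] := ug; exact: (borel_fun_measurable hP). Qed.

Lemma scale_ge0 : 0 <= T.
Proof. by rewrite divr_ge0 ?mulr_ge0// ltW. Qed.

Lemma radius_gt0 i : 0 < radius i.
Proof. by rewrite mulr_gt0// exprn_gt0// invr_gt0. Qed.

Lemma radius_le i : radius i <= r.
Proof.
apply: ler_piMr; first exact: ltW.
by rewrite exprn_ile1 ?invr_ge0// invf_le1// ler1n.
Qed.

Lemma radiusS i : radius i = 2 * radius i.+1.
Proof. by rewrite /radius exprS; field. Qed.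

Lemma oscillation_small y i : ball x r y ->
  (\int[mu]_(z in ball y (radius i)) `|u z - (avg u y (radius i))%:E| <=
    (vol y (radius i) * (chain_const * T * chain_ratio ^+ i))%:E)%E.
Proof.
move=> xy; have ri0 := radius_gt0 i.
have lri0 : 0 < lam * radius i by rewrite mulr_gt0.
have ri_r : lam * radius i <= lam * r by rewrite ler_pM2l// radius_le.
have lr : r <= lam * r by rewrite ler_peMl// ltW.
have y2 : ball x (2 * lam * r) y.
  by move: xy; rewrite !ballEmdist/=; lra.
have sub : ball y (lam * radius i) `<=` ball x (2 * lam * r).
  by apply: ball_sub; move: xy; rewrite ballEmdist/=; lra.
apply: le_trans (oscillation_le hP cPI0 p0 ri0 lam1 lr0 (hPI y ri0 Lu ug) sub Lu mh hJ) _.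
rewrite lee_fin ler_pM2l ?(vol_gt0 hP)//.
have le2 : lam * radius i <= 2 * lam * r by lra.
have := hdim lri0 le2 y2.
(* The reference radius is [2 * lam * r] and not [lam * r], so as to contain the dilated balls
   around every [y] in [ball x r]; hence the exponent [i.+1]. *)
have -> : lam * radius i / (2 * lam * r) = 2^-1 ^+ i.+1.
  by rewrite /radius exprS; field; rewrite !lt0r_neq0.
rewrite ler_pdivlMr ?(vol_gt0 hP)// => V_ge.
have D0 : 0 < cs `^ p^-1 * halfpow ^+ i.+1 * W.
  apply: mulr_gt0 => //; apply: mulr_gt0; first exact: powR_gt0.
  exact/exprn_gt0/halfpow_gt0.
have V_ge' : cs `^ p^-1 * halfpow ^+ i.+1 * W <= vol y (lam * radius i) `^ p^-1.
  apply: le_trans (ge0_ler_powR _ _ _ V_ge); rewrite ?nnegrE ?invr_ge0.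
  - have c1 := ltW cs0; have V1 := ltW (vol_gt0 hP x lr0).
    have X1 : 0 <= (2^-1 ^+ i.+1 : R) by rewrite exprn_ge0.
    rewrite powRM ?mulr_ge0 ?powR_ge0// powRM ?powR_ge0// -powRrM.
    rewrite /halfpow -[X in cs `^ _ * X](powR_mulrn _ (powR_ge0 _ _)) powRAC.
    by rewrite powR_mulrn.
  - by rewrite ltW.
  - by rewrite !mulr_ge0 ?powR_ge0// ltW ?(vol_gt0 hP).
  - by rewrite ltW ?(vol_gt0 hP).
apply: (@le_trans _ _ (cPI * (2 * radius i) *
    (J / (cs `^ p^-1 * halfpow ^+ i.+1 * W)))).
  apply: ler_wpM2l; first by rewrite !mulr_ge0 ?ltW.
  apply: ler_wpM2l => //; rewrite lef_pV2 ?posrE//.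
  exact: lt_le_trans V_ge'.
rewrite le_eqVlt; apply/orP; left; apply/eqP.
rewrite /chain_const /chain_ratio /T /radius expr_div_n exprS.
have hp0 := halfpow_gt0; have c0 : 0 < cs `^ p^-1 by exact: powR_gt0.
have hpi : 0 < halfpow ^+ i by rewrite exprn_gt0.
by field; rewrite !lt0r_neq0.
Qed.

(** The dilate of [ball x (2 * r)] in the Poincare inequality is exactly the ball on which [J] is
    given. *)
Lemma oscillation_double :
  (\int[mu]_(z in ball x (2 * r)) `|u z - (avg u x (2 * r))%:E| <=
    (vol x (2 * r) * (4 * cPI * T))%:E)%E.
Proof.
have r20 : 0 < 2 * r by rewrite mulr_gt0.
have E : lam * (2 * r) = 2 * lam * r by ring.
have sub : ball x (lam * (2 * r)) `<=` ball x (2 * lam * r) by rewrite E.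
apply: le_trans (oscillation_le hP cPI0 p0 r20 lam1 lr0 (hPI x r20 Lu ug) sub Lu mh hJ) _.
rewrite lee_fin ler_pM2l ?(vol_gt0 hP)// E -/W /T.
by rewrite le_eqVlt; apply/orP; left; apply/eqP; field; rewrite lt0r_neq0.
Qed.

(** Both averages are compared with the one over [ball x (2 * r)], which contains both balls; the
    dimension condition bounds the volume ratios, and the two comparisons turn 4 into 8. *)
Lemma avg_near_center y : ball x r y ->
  `|avg u y r - avg u x r| <= 8 * cPI * (cs * 2^-1 `^ s)^-1 * T.
Proof.
move=> xy; have r20 : 0 < 2 * r by rewrite mulr_gt0.
have D0 : 0 < cs * 2^-1 `^ s by rewrite mulr_gt0// powR_gt0.
have H z : ball x r z ->
    `|avg u z r - avg u x (2 * r)| <= (cs * 2^-1 `^ s)^-1 * (4 * cPI * T).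
  move=> xz; have sub : ball z r `<=` ball x (2 * r).
    by apply: ball_sub; move: xz; rewrite ballEmdist/=; lra.
  apply: le_trans (avg_dist_le hP r20 r0 sub (Lu x r20) oscillation_double) _.
  apply: ler_wpM2r; first by rewrite mulr_ge0 ?scale_ge0// ltW// mulr_gt0.
  have le2 : r <= 2 * r by lra.
  have z2 : ball x (2 * r) z by move: xz; rewrite !ballEmdist/=; lra.
  have := hdim r0 le2 z2.
  rewrite (_ : r / (2 * r) = 2^-1); last by field; rewrite lt0r_neq0.
  rewrite -lef_pV2 ?posrE ?divr_gt0 ?(vol_gt0 hP)//.
  by rewrite invf_div.
have xx : ball x r x by exact: ballxx.
have := ler_normB (avg u y r - avg u x (2 * r)) (avg u x r - avg u x (2 * r)).
rewrite opprB addrA subrK; have := H _ xy; have := H _ xx.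
move: (avg u y r) (avg u x r) (avg u x (2 * r)) => m1 m2 m3.
by move: (cs * _)^-1 => D; lra.
Qed.

Lemma avg_step y i : ball x r y ->
  `|avg u y (radius i.+1) - avg u y (radius i)| <=
    cdbl * (chain_const * T * chain_ratio ^+ i).
Proof.
move=> xy; have ri0 := radius_gt0 i; have rS0 := radius_gt0 i.+1.
have sub : ball y (radius i.+1) `<=` ball y (radius i).
  by apply: ball_sub; rewrite mdistxx add0r (radiusS i) ler_peMl ?ler1n ?ltW.
apply: le_trans (avg_dist_le hP ri0 rS0 sub (Lu y ri0) (oscillation_small i xy)) _.
apply: ler_wpM2r.
  apply: mulr_ge0; last exact/exprn_ge0/ltW/chain_ratio_gt0.
  by apply: mulr_ge0; [exact/ltW/chain_const_gt0|exact: scale_ge0].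
by rewrite ler_pdivrMr ?(vol_gt0 hP)// (radiusS i) hdbl.
Qed.

Lemma avg_uniform y i : ball x r y ->
  `|avg u y (radius i) - avg u x r| <= sup_const * T.
Proof.
move=> xy; have q1 := chain_ratio_lt1; have q0 := chain_ratio_gt0.
have T0 := scale_ge0; have c0 := chain_const_gt0.
have V0 := vol_gt0 hP x r0.
have cd0 : 0 <= cdbl.
  rewrite -(pmulr_lge0 _ V0); apply: le_trans (hdbl x r0).
  by rewrite ltW// (vol_gt0 hP)// mulr_gt0.
(* The induction carries the exact partial geometric sum, since the bound by the full series does
   not pass from [i] to [i.+1]. *)
have H : `|avg u y (radius i) - avg u x r| <=
    8 * cPI * (cs * 2^-1 `^ s)^-1 * T +
    cdbl * (chain_const * T) * ((1 - chain_ratio ^+ i) / (1 - chain_ratio)).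
  elim: i => [|i ih].
    by rewrite /radius expr0 mulr1 subrr mul0r mulr0 addr0 avg_near_center.
  have := avg_step i xy; have := ler_normD (avg u y (radius i.+1) - avg u y (radius i))
    (avg u y (radius i) - avg u x r).
  rewrite subrKA exprS.
  have -> : (1 - chain_ratio * chain_ratio ^+ i) / (1 - chain_ratio) =
      (1 - chain_ratio ^+ i) / (1 - chain_ratio) + chain_ratio ^+ i.
    by field; rewrite subr_eq0 gt_eqF.
  move: ih; move: (_ / (1 - chain_ratio)) => w.
  by rewrite mulrDr [cdbl * (_ * chain_ratio ^+ i)]mulrA; lra.
apply: le_trans H _; rewrite /sup_const [leRHS]mulrDl lerD2l.
rewrite [leRHS](_ : _ = cdbl * (chain_const * T) * (1 - chain_ratio)^-1); last by ring.
apply: ler_wpM2l.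
  by apply: mulr_ge0 => //; apply: mulr_ge0 => //; exact: ltW.
apply: ler_piMl; first by rewrite invr_ge0 subr_ge0 ltW.
by rewrite gerBl exprn_ge0// ltW.
Qed.

End chaining.

(** * Finite maximal separated sets in balls *)

Section finite_nets.
Context (R : realType) (d : measure_display) (P : metricMeasurableType d R).
Variable mu : {measure set P -> \bar R}.
Hypothesis hP : metric_measure_space mu.
Local Notation mball := (measurable_ball_metric hP).
Local Notation vol := (vol mu).

Definition separated_in (x : P) (r t : R) (n : nat) (c : nat -> P) :=
  (forall i, (i < n)%N -> ball x r (c i)) /\
  (forall i j, (i < j)%N -> (j < n)%N -> t <= mdist (c i) (c j)).

(** The balls of radius [t / 2] around [t]-separated points are disjoint, and they lie in
    [ball x (2 * r)]. *)
Lemma separated_vol x r t n c : 0 < t -> t <= r -> separated_in x r t n c ->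
  \sum_(i < n) vol (c i) (t / 2) <= vol x (2 * r).
Proof.
move=> t0 tr [cB csep].
have r0 : 0 < r := lt_le_trans t0 tr.
have t20 : 0 < t / 2 by rewrite divr_gt0.
have r20 : 0 < 2 * r by rewrite mulr_gt0.
rewrite -lee_fin -sumEFin.
rewrite (eq_bigr (fun i : 'I_n => mu (ball (c i) (t / 2)))); last first.
  by move=> i _; rewrite volE.
have disj i j y : (i < j)%N -> (j < n)%N -> ball (c i) (t / 2) y ->
    ball (c j) (t / 2) y -> False.
  move=> ij jn; rewrite !ballEmdist/= => iy jy.
  have := csep _ _ ij jn; have := metric_triangle (c i) y (c j).
  by rewrite [mdist y _]metric_sym; lra.
rewrite -(@measure_bigsetU_ord _ _ _ mu n xpredT (fun i => ball (c i) (t / 2))).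
- rewrite -volE//; apply: le_measure; rewrite ?inE.
  + by apply: bigsetU_measurable => i _; exact: mball.
  + exact: mball.
  + rewrite -(bigcup_mkord n (fun i => ball (c i) (t / 2))) => y [i /= iN].
    apply: ball_sub; have := cB _ iN; rewrite ballEmdist/=; lra.
- by move=> i; exact: mball.
- apply/trivIsetP => i j _ _ ij; rewrite -subset0 => y [iy jy].
  have : (i < j)%N || (j < i)%N by rewrite -neq_ltn.
  by case/orP => [/disj|/disj]; [apply; [exact: ltn_ord|exact: iy|exact: jy]|
    apply; [exact: ltn_ord|exact: jy|exact: iy]].
Qed.

Variables (cs s : R).
Hypothesis cs0 : 0 < cs.
Hypothesis hdim : forall (x y : P) (r R0 : R), 0 < r -> r <= R0 ->
  ball x R0 y -> cs * (r / R0) `^ s <= vol y r / vol x R0.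

(** The dimension condition bounds the half-radius balls below by a common volume [v], so separated
    sets have bounded cardinality; one of maximal cardinality covers. *)
Lemma finite_net x r t : 0 < t -> t <= r -> exists n c,
  separated_in x r t n c /\
  forall y, ball x r y -> exists2 i, (i < n)%N & ball (c i) t y.
Proof.
move=> t0 tr; have r0 : 0 < r := lt_le_trans t0 tr.
have t20 : 0 < t / 2 by rewrite divr_gt0.
have t2r : t / 2 <= r by lra.
pose v := cs * (t / 2 / r) `^ s * vol x r.
have v0 : 0 < v by rewrite !mulr_gt0 ?powR_gt0 ?(vol_gt0 hP)// divr_gt0.
pose Q n := `[< exists c, separated_in x r t n c >].
have Q0 : exists n, Q n by exists 0%N; apply/asboolP; exists (fun=> x); split.
have Qle n : Q n -> (n <= Num.trunc (vol x (2 * r) / v))%N.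
  move=> /asboolP[c sc]; rewrite -ltnS.
  have : n%:R <= vol x (2 * r) / v.
    rewrite ler_pdivlMr//; apply: le_trans (separated_vol t0 tr sc).
    rewrite mulr_natl -[X in v *+ X]card_ord -sumr_const; apply: ler_sum => i _.
    have := hdim t20 t2r (proj1 sc i (ltn_ord i)).
    by rewrite ler_pdivlMr ?(vol_gt0 hP).
  move=> H; rewrite -(@ltr_nat R); apply: le_lt_trans H _; exact: truncnS_gt.
case: (ex_maxnP Q0 Qle) => n /asboolP[c sc] nmax; exists n, c; split => // y xy.
apply: contrapT => H.
suff /nmax : Q n.+1 by rewrite ltnn.
(* A point [y] left uncovered could be appended at index [n], against maximality. *)
apply/asboolP; exists (fun k => if (k < n)%N then c k else y).
case: sc => cB csep; split => [i _|i j ij].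
  by case: ifPn => [/cB|].
rewrite ltnS leq_eqVlt => /predU1P[jn|jn]; last first.
  by rewrite jn (ltn_trans ij jn); exact: csep.
rewrite jn ltnn in ij *; rewrite ij leNgt; apply/negP => iy.
by apply: H; exists i => //; rewrite ballEmdist.
Qed.

End finite_nets.

(** * From oscillation at small scales to an almost everywhere bound *)

Section null_superlevel.
Context (R : realType) (d : measure_display) (P : metricMeasurableType d R).
Variable mu : {measure set P -> \bar R}.
Hypothesis hP : metric_measure_space mu.
Local Notation mball := (measurable_ball_metric hP).
Local Notation vol := (vol mu).
Local Notation avg := (avg mu).
Variables (cdbl cs s : R).
Hypothesis hdbl : forall (x : P) (r : R), 0 < r ->
  vol x (2 * r) <= cdbl * vol x r.
Hypothesis cs0 : 0 < cs.
Hypothesis hdim : forall (x y : P) (r R0 : R), 0 < r -> r <= R0 ->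
  ball x R0 y -> cs * (r / R0) `^ s <= vol y r / vol x R0.
Local Open Scope ereal_scope.

(* Covering the ball by the balls of a maximal separated set replaces the
   Lebesgue differentiation theorem: where the averages are within [a] of [M],
   the excess of |u - M| over [a] is at most the oscillation |u - avg|. *)
Lemma superlevel_null (u : P -> \bar R) (x : P) (r M a k q : R) :
  measurable_fun [set: P] u -> (0 < r)%R -> (0 <= k)%R -> (0 <= q < 1)%R ->
  (forall y i, ball x r y ->
    \int[mu]_(z in ball y (radius r i)) `|u z - (avg u y (radius r i))%:E| <=
    (vol y (radius r i) * (k * q ^+ i))%:E) ->
  (forall y i, ball x r y -> (`|avg u y (radius r i) - M| <= a)%R) ->
  mu [set y | ball x r y /\ a%:E < `|u y - M%:E|] = 0.
Proof.
move=> mu_u r0 k0 /andP[q0 q1] osc avgM.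
pose G y := maxe (`|u y - M%:E| - a%:E) 0.
have G0 y : 0 <= G y by rewrite /G le_max lexx orbT.
have mG : measurable_fun [set: P] G.
  apply: measurable_maxe => //; apply: emeasurable_funB => //.
  by apply: measurableT_comp => //; exact: emeasurable_funB.
have mGr y t : measurable_fun [set: P] (G \_ (ball y t)).
  exact: (@measurable_restrictT _ _ P _ _ G (mball y t)).1 (measurable_funTS mG).
(* The balls of the net may overlap, but doubling bounds each by its half-radius ball, and those are
   disjoint inside [ball x (2 * r)]. The total volume is thus bounded independently of [i], and
   [q ^+ i] tends to 0. *)
pose D := (cdbl * vol x (2 * r) * k)%R.
have bound i : \int[mu]_(y in ball x r) G y <= (D * q ^+ i)%:E.
  have t0 := radius_gt0 r0 i; have tr := radius_le r0 i.
  have [n [c [sc cov]]] := finite_net hP cs0 hdim x t0 tr.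
  set t := radius r i in t0 tr sc cov *.
  have t20 : (0 < t / 2)%R by rewrite divr_gt0.
  apply: (@le_trans _ _ (\int[mu]_(y in ball x r)
      \sum_(j < n) (G \_ (ball (c j) t)) y)).
    apply: le_integral_ge0 => y xy; first exact: G0.
    have [j jn jy] := cov y xy.
    rewrite (bigD1 (Ordinal jn))//= patchE mem_set// leeDl//.
    by apply: sume_ge0 => l _; exact: erestrict_ge0.
  rewrite ge0_integral_sum//; [|exact: mball| |]; last 2 first.
  - move=> j; apply: measurable_funTS.
    exact: mGr.
  - by move=> j y _; exact: erestrict_ge0.
  apply: (@le_trans _ _ (\sum_(j < n) (cdbl * vol (c j) (t / 2) * (k * q ^+ i))%:E)).
    apply: lee_sum => j _; have cj := proj1 sc j (ltn_ord j).
    apply: (@le_trans _ _ (\int[mu]_(y in ball (c j) t) G y)).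
      rewrite [leRHS]integral_mkcond; apply: ge0_subset_integral => //.
      + exact: mball.
      + by move=> y _; exact: erestrict_ge0.
    apply: (@le_trans _ _ (vol (c j) t * (k * q ^+ i))%:E).
      apply: le_trans (osc _ i cj); apply: le_integral_ge0 => y _ //.
      rewrite /G ge_max abse_ge0 andbT.
      have := avgM _ i cj; rewrite -/t; move: (avg _ _ _) => m mM.
      case: (u y) => [v| |]; [|by rewrite leey|by rewrite leey].
      rewrite -!EFinB !abse_EFin lee_fin.
      by have := ler_normD (v - m)%R (m - M)%R; rewrite subrKA; lra.
    rewrite lee_fin; apply: ler_wpM2r; first by rewrite mulr_ge0// exprn_ge0.
    by have := hdbl (c j) t20; rewrite mulrC divfK.
  rewrite sumEFin lee_fin -mulr_suml -mulr_sumr.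
  rewrite /D -[leRHS]mulrA; apply: ler_wpM2r.
    by rewrite mulr_ge0// exprn_ge0.
  apply: ler_wpM2l (separated_vol hP t0 tr sc).
  have V0 := vol_gt0 hP x r0.
  rewrite -(pmulr_lge0 _ V0); apply: le_trans (hdbl x r0).
  by rewrite ltW// (vol_gt0 hP)// mulr_gt0.
have I0 : \int[mu]_(y in ball x r) G y = 0.
  apply/eqP; rewrite eq_le integral_ge0// andbT.
  apply/lee_addgt0Pr => e e0; rewrite add0e.
  have cv : (D * q ^+ i)%R @[i --> \oo] --> (D * 0)%R.
    by apply: cvgMl_tmp; apply: cvg_expr; rewrite ger0_norm.
  have : (D * 0 < e)%R by rewrite mulr0.
  move=> /(cvgr_lt _ cv) [i _ /(_ i (leqnn i))] /= Di.
  by apply: le_trans (bound i) _; rewrite lee_fin ltW.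
have mB := mball x r.
have mG' : measurable_fun (ball x r) G by exact: measurable_funTS.
have : \int[mu]_(y in ball x r) `|G y| = 0.
  by rewrite -I0; apply: eq_integral => y _; rewrite gee0_abs.
move=> /(ae_eq_integral_abs mu mB mG') [Z [mZ Z0 GZ]].
apply/negligibleP.
  rewrite (_ : mkset _ = ball x r `&` [set y | a%:E < `|u y - M%:E|])//.
  apply: emeasurable_fun_o_infty => //.
  apply: measurableT_comp => //; apply: emeasurable_funB => //.
  exact: measurable_funTS.
exists Z; split => // y [xy ay]; apply: GZ => /= /(_ xy) G0y.
have : `|u y - M%:E| - a%:E <= G y by rewrite /G le_max lexx.
by rewrite G0y leNgt sube_gt0 ay.
Qed.

End null_superlevel.

(** * Function lattices *)

Section function_lattice.
Context (R : realType) (d : measure_display) (P : metricMeasurableType d R).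
Variable mu : {measure set P -> \bar R}.
Variables (cD : R) (N : (P -> \bar R) -> \bar R) (p : R) (cemb : P -> R -> R).
Hypothesis hP : metric_measure_space mu.
Hypothesis hX : quasi_Banach_function_lattice mu cD N.
Hypothesis hp1 : (1 <= p)%R.
Hypothesis hemb : embeds_Lploc mu N p cemb.
Local Notation mball := (measurable_ball_metric hP).
Local Open Scope ereal_scope.

Let p0 : (0 < p)%R := lt_le_trans ltr01 hp1.

Lemma measurable_patch_ball (f : P -> \bar R) x r :
  measurable_fun [set: P] f -> measurable_fun [set: P] (f \_ (ball x r)).
Proof.
move=> mf.
exact: (@measurable_restrictT _ _ P _ _ f (mball x r)).1 (measurable_funTS mf).
Qed.

Lemma lattice_patch_le (f : P -> \bar R) x r : measurable_fun [set: P] f ->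
  N (f \_ (ball x r)) <= N f.
Proof.
move=> mf; apply: (qbfl_lattice hX) => //; first exact: measurable_patch_ball.
apply: aeW => y; rewrite patchE; case: ifPn => // _.
by rewrite abse0 abse_ge0.
Qed.

Lemma Lnorm_patch (f : P -> \bar R) x r :
  'N[mu]_(p%:E)[f \_ (ball x r)] =
  (\int[mu]_(y in ball x r) (`|f y| `^ p)) `^ p^-1.
Proof.
rewrite unlock; congr (_ `^ _); rewrite [RHS]integral_mkcond.
apply: eq_integral => y _; rewrite !patchE; case: ifPn => // _.
by rewrite abse0 poweR0r// gt_eqF.
Qed.

Lemma cemb_gt0 x r : (0 < r)%R -> (0 < cemb x r)%R.
Proof. by move=> r0; have [[]] := hemb x r0. Qed.

Lemma Lnorm_ball_le (f : P -> \bar R) x r : (0 < r)%R ->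
  measurable_fun [set: P] f ->
  (\int[mu]_(y in ball x r) (`|f y| `^ p)) `^ p^-1 <=
    (cemb x r)%:E * N (f \_ (ball x r)).
Proof.
by move=> r0 mf; rewrite -Lnorm_patch; have [[_ H] _] := hemb x r0; exact: H.
Qed.

(** The embedding gives local integrability of |u|^p, and |u| is at most 1 + |u|^p on a ball of
    finite measure, as [1 <= p]. *)
Lemma lattice_L1loc (u : P -> \bar R) : measurable_fun [set: P] u ->
  N u < +oo -> L1loc mu u.
Proof.
move=> mu_u Nu x r r0; apply/integrableP.
split; first exact: measurable_funTS.
have Nfin : (cemb x r)%:E * N (u \_ (ball x r)) < +oo.
  apply: lte_mul_pinfty; rewrite ?lee_fin ?ltW ?cemb_gt0//.
  exact: le_lt_trans (lattice_patch_le _ _ mu_u) Nu.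
have Ip : \int[mu]_(y in ball x r) (`|u y| `^ p) < +oo.
  apply: (@lty_poweRy _ _ p^-1); first by rewrite gt_eqF// invr_gt0.
  exact: le_lt_trans (Lnorm_ball_le x r0 mu_u) Nfin.
have m1 : measurable_fun (ball x r) (fun y => `|u y| `^ p).
  apply: measurable_funTS; apply: (measurableT_comp (measurable_poweR _)).
  exact: measurableT_comp.
apply: (@le_lt_trans _ _ (\int[mu]_(y in ball x r) (1 + `|u y| `^ p))).
  apply: le_integral_ge0 => y _; first exact: abse_ge0.
  case: (u y) => [t| |] /=; rewrite ?gt_eqF ?addey//.
  rewrite -EFinD lee_fin; have [t1|/ltW t1] := leP `|t|%R 1%R.
    by apply: ler_wpDr; rewrite ?powR_ge0.
  by apply: ler_wpDl => //; exact: le1r_powR.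
rewrite ge0_integralD//; [|exact: mball|by move=> y _; exact: poweR_ge0].
rewrite integral_cst; last exact: mball.
by rewrite mul1e lte_add_pinfty// volE// ltry.
Qed.

(** A function cut off to the smaller ball is unchanged by the cut-off to the larger one, so the
    larger ball's constant is admissible for the smaller ball; minimality concludes. *)
Lemma cemb_mono x r y t : (0 < r)%R -> (0 < t)%R -> ball x r `<=` ball y t ->
  (cemb x r <= cemb y t)%R.
Proof.
move=> r0 t0 xy; have [_] := hemb x r0; apply; split; first exact: cemb_gt0.
move=> f mf; have [[_ H] _] := hemb y t0.
have E : (f \_ (ball x r)) \_ (ball y t) = f \_ (ball x r).
  by rewrite -patch_setI setIidr.
by have := H _ (measurable_patch_ball x r mf); rewrite E.
Qed.

Lemma lattice_approx_le (g g' rho : P -> \bar R) x r (e : R) :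
  measurable_fun [set: P] g -> measurable_fun [set: P] g' ->
  measurable_fun [set: P] rho -> {ae mu, forall y, g' y = g y} -> (0 < e)%R ->
  N ((fun y => g' y + e%:E * rho y) \_ (ball x r)) <=
    cD%:E * (N (g \_ (ball x r)) + e%:E * N rho).
Proof.
move=> mg mg' mrho g'g e0.
have mer : measurable_fun [set: P] (fun y => e%:E * rho y) by exact: measurable_funeM.
have -> : (fun y => g' y + e%:E * rho y) \_ (ball x r) =
    g' \_ (ball x r) \+ (fun y => e%:E * rho y) \_ (ball x r).
  by apply/funext => y /=; rewrite !patchE; case: ifPn => // _; rewrite adde0.
have cD0 : (0 <= cD)%R by rewrite (le_trans ler01)// (qbfl_modulus hX).
apply: le_trans (qbfl_triangle hX _ _) _; [exact: measurable_patch_ball..|].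
apply: lee_wpmul2l; first by rewrite lee_fin.
apply: leeD.
  apply: (qbfl_lattice hX); [exact: measurable_patch_ball..|].
  apply: filterS g'g => y g'gy; rewrite !patchE; case: ifPn => // _.
  by rewrite g'gy.
apply: le_trans (lattice_patch_le _ _ mer) _.
by rewrite (qbfl_homogeneous hX)// gtr0_norm.
Qed.

Variables (cs s lam : R).
Hypothesis cs0 : (0 < cs)%R.
Hypothesis hdim : forall (x y : P) (r R0 : R), (0 < r)%R -> (r <= R0)%R ->
  ball x R0 y -> (cs * (r / R0) `^ s <= vol mu y r / vol mu x R0)%R.
Hypothesis lam1 : (1 <= lam)%R.

(** [embedding_scale] is the factor [M] of the theorem, and [embedding_growth] at [x0] and [R0] is
    its [K]. *)
Definition embedding_scale (x : P) (r : R) : R :=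
  (cemb x (2 * lam * r) * r / vol mu x (2 * lam * r) `^ p^-1)%R.

Definition embedding_growth (x : P) (r : R) : R :=
  (cemb x (2 * lam * r) * (r `^ s / vol mu x (2 * lam * r)) `^ p^-1)%R.

Let lr_gt0 r : (0 < r)%R -> (0 < 2 * lam * r)%R.
Proof. by move=> r0; rewrite !mulr_gt0// (lt_le_trans ltr01). Qed.

Lemma embedding_scale_ge0 x r : (0 < r)%R -> (0 <= embedding_scale x r)%R.
Proof.
move=> r0; rewrite /embedding_scale divr_ge0 ?powR_ge0// mulr_ge0 ?ltW//.
exact/cemb_gt0/lr_gt0.
Qed.

Lemma embedding_growth_gt0 x r : (0 < r)%R -> (0 < embedding_growth x r)%R.
Proof.
move=> r0; rewrite /embedding_growth mulr_gt0 ?cemb_gt0 ?lr_gt0//.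
by rewrite powR_gt0// divr_gt0 ?powR_gt0// (vol_gt0 hP)// lr_gt0.
Qed.

(** The numerator is controlled by monotonicity of the embedding constant, the denominator by the
    dimension condition; its p-th root supplies the factor (r / R1)^(s/p). *)
Lemma embedding_scale_le x0 x (R1 r : R) : (0 < r)%R -> (r <= R1)%R ->
  ball x0 (2 * lam * R1) x ->
  ball x (2 * lam * r) `<=` ball x0 (2 * lam * R1) ->
  (embedding_scale x r <=
    (cs `^ p^-1)^-1 * embedding_growth x0 R1 * r `^ (1 - s / p))%R.
Proof.
move=> r0 rR xx0 sub; have R10 : (0 < R1)%R := lt_le_trans r0 rR.
have lr0 := lr_gt0 r0; have lR0 := lr_gt0 R10.
have lam0 : (0 < lam)%R := lt_le_trans ltr01 lam1.
have c12 := cemb_mono lr0 lR0 sub.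
have V1 := vol_gt0 hP x0 lR0; have V2 := vol_gt0 hP x lr0.
have lrR : (2 * lam * r <= 2 * lam * R1)%R by rewrite ler_pM2l// mulr_gt0.
have := hdim lr0 lrR xx0.
rewrite (_ : 2 * lam * r / (2 * lam * R1) = r / R1)%R; last first.
  by field; rewrite !lt0r_neq0.
rewrite ler_pdivlMr// => Vge.
set A := (r `^ (s / p))%R; set B := (R1 `^ (s / p))%R.
set W1 := (vol mu x0 (2 * lam * R1) `^ p^-1)%R.
set W2 := (vol mu x (2 * lam * r) `^ p^-1)%R.
have A0 : (0 < A)%R by exact: powR_gt0.
have B0 : (0 < B)%R by exact: powR_gt0.
have W10 : (0 < W1)%R by exact: powR_gt0.
have k0 : (0 < cs `^ p^-1)%R by exact: powR_gt0.
have Wge : (cs `^ p^-1 * (A / B) * W1 <= W2)%R.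
  have := ge0_ler_powR _ _ _ Vge; rewrite !nnegrE => /(_ p^-1%R) H.
  apply: le_trans (H _ _ _); last first.
  - exact: ltW.
  - by rewrite !mulr_ge0 ?powR_ge0// ltW.
  - by rewrite invr_ge0 ltW.
  have X0 : (0 <= (r / R1) `^ s)%R := powR_ge0 _ _.
  have := powRM p^-1 (mulr_ge0 (ltW cs0) X0) (ltW V1) => ->.
  have := powRM p^-1 (ltW cs0) X0 => ->.
  rewrite -powRrM.
  have RV0 : (0 <= R1^-1)%R by rewrite invr_ge0 ltW.
  have := powRM (s / p) (ltW r0) RV0 => ->.
  by rewrite powRV// ltW.
rewrite /embedding_scale /embedding_growth -/W2.
rewrite powRM ?powR_ge0 ?invr_ge0 ?(ltW V1)// -powRrM powRV ?(ltW V1)//.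
rewrite -/B -/W1 powRB ?powRr1 ?(ltW r0) ?(gt_eqF r0) ?implybT// -/A.
have D0 : (0 < cs `^ p^-1 * (A / B) * W1)%R by rewrite !mulr_gt0 ?invr_gt0.
apply: (@le_trans _ _ (cemb x0 (2 * lam * R1) * r / (cs `^ p^-1 * (A / B) * W1))%R).
  apply: ler_pM.
  - by rewrite mulr_ge0 ?(ltW r0)// ltW// cemb_gt0.
  - by rewrite invr_ge0 powR_ge0.
  - by rewrite ler_pM2r.
  - by rewrite lef_pV2 ?posrE// powR_gt0.
by rewrite le_eqVlt; apply/orP; left; apply/eqP; field; rewrite !lt0r_neq0.
Qed.

Variable cdbl cPI : R.
Hypothesis hdbl : forall (x : P) (r : R), (0 < r)%R ->
  (vol mu x (2 * r) <= cdbl * vol mu x r)%R.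
Hypotheses (s0 : (0 < s)%R) (sp : (s < p)%R) (cPI0 : (0 < cPI)%R).
Hypothesis hPI : forall (x : P) (r : R), (0 < r)%R -> forall u g : P -> \bar R,
  L1loc mu u -> upper_gradient g u ->
  mean mu (ball x r) (fun y => `|u y - mean mu (ball x r) u|) <=
    cPI%:E * diam (ball x r) *
      (mean mu (ball x (lam * r)) (fun y => g y `^ p)) `^ p^-1.

Lemma cap_ess_sup_upper_gradient (u h : P -> \bar R) x (r : R) : (0 < r)%R ->
  measurable_fun [set: P] u -> N u < +oo -> upper_gradient h u -> N h < +oo ->
  cap_ess_sup N (ball x r) (fun y => `|u y - mean mu (ball x r) u|) <=
    (sup_const cdbl cs cPI p s * embedding_scale x r)%:E *
      N (h \_ (ball x (2 * lam * r))).
Proof.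
move=> r0 mu_u Nu ug Nh; have [bh h0 _] := ug.
have mh := borel_fun_measurable hP bh.
have Lu := lattice_L1loc mu_u Nu.
have lr0 := lr_gt0 r0.
have Nf : N (h \_ (ball x (2 * lam * r))) \is a fin_num.
  rewrite ge0_fin_numE ?(qbfl_ge0 hX)//; last exact: measurable_patch_ball.
  exact: le_lt_trans (lattice_patch_le _ _ mh) Nh.
pose J := (cemb x (2 * lam * r) * fine (N (h \_ (ball x (2 * lam * r)))))%R.
have hJ : (\int[mu]_(y in ball x (2 * lam * r)) (h y `^ p)) `^ p^-1 <= J%:E.
  rewrite /J EFinM fineK//; apply: le_trans (Lnorm_ball_le x lr0 mh).
  by under eq_integral do rewrite -{1}(gee0_abs (h0 _)).
rewrite (mean_fin hP r0 (Lu x r r0)).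
have -> : (sup_const cdbl cs cPI p s * embedding_scale x r)%:E *
    N (h \_ (ball x (2 * lam * r))) =
    (sup_const cdbl cs cPI p s * (r * J / vol mu x (2 * lam * r) `^ p^-1))%:E.
  rewrite -{1}(fineK Nf) -EFinM; congr EFin; rewrite /embedding_scale /J.
  by move: (fine _) (_ `^ p^-1)%R => a b; ring.
(* It suffices that the superlevel set at this level has capacity zero, and for that it suffices
   that it is a null set. *)
apply: ereal_inf_lbound; eexists; last reflexivity.
apply: (capacity_superlevel_null hP hX mu_u ug Nh).
have q0 := chain_ratio_gt0 p s; have q1 := chain_ratio_lt1 s0 sp.
apply: (superlevel_null hP hdbl cs0 hdim mu_u r0 _ _
  (fun y i => @oscillation_small _ _ _ _ hP _ _ _ _ _ cs0 hdim s0 sp lam1 cPI0 hPI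
    _ _ _ _ _ Lu ug r0 hJ y i)
  (fun y i => @avg_uniform _ _ _ _ hP _ _ _ _ _ _ hdbl cs0 hdim s0 sp lam1 cPI0 hPI
    _ _ _ _ _ Lu ug r0 hJ y i)).
- apply: mulr_ge0; first exact/ltW/chain_const_gt0.
  exact: (scale_ge0 hP lam1 r0 hJ).
- by rewrite ltW.
Qed.

(** The previous bound is applied to the upper gradient [g' + e * rho]; splitting off [e * rho]
    costs the modulus [cD] of the quasi-norm, and that term vanishes with [e]. *)
Lemma cap_ess_sup_weak_upper_gradient (u g : P -> \bar R) x (r : R) :
  (0 < r)%R -> in_newtonian N u -> in_lattice N g -> weak_upper_gradient N g u ->
  cap_ess_sup N (ball x r) (fun y => `|u y - mean mu (ball x r) u|) <=
    (sup_const cdbl cs cPI p s * cD * embedding_scale x r)%:E *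
      N (g \_ (ball x (2 * lam * r))).
Proof.
move=> r0 [mu_u Nu1] [mg Ng] wug.
have Nu : N u < +oo.
  apply: le_lt_trans Nu1; rewrite /newtonian_norm leeDl//.
  apply: le_ereal_inf_tmp => _ [k [bk _ _] <-].
  by rewrite (qbfl_ge0 hX)//; exact: (borel_fun_measurable hP).
have [g' [rho [mg' g'g [mrho Nrho] ugh]]] := weak_upper_gradient_approx hP wug.
set n := N (g \_ _); set C0 := sup_const _ _ _ _ _; set M := embedding_scale x r.
have M0 : (0 <= M)%R := embedding_scale_ge0 x r0.
have cd0 : (0 <= cdbl)%R.
  rewrite -(pmulr_lge0 _ (vol_gt0 hP x r0)); apply: le_trans (hdbl x r0).
  by rewrite ltW// (vol_gt0 hP)// mulr_gt0.
have C00 : (0 <= C0)%R := sup_const_ge0 cs0 s0 sp cPI0 cd0.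
have cD0 : (0 <= cD)%R by rewrite (le_trans ler01)// (qbfl_modulus hX).
have mgB := measurable_patch_ball x (2 * lam * r) mg.
have n_fin : n \is a fin_num.
  rewrite ge0_fin_numE ?(qbfl_ge0 hX)//.
  exact: le_lt_trans (lattice_patch_le _ _ mg) Ng.
have rho_fin : N rho \is a fin_num by rewrite ge0_fin_numE ?(qbfl_ge0 hX).
have v0 : (0 <= fine (N rho))%R by rewrite fine_ge0// (qbfl_ge0 hX).
have bound (e : R) : (0 < e)%R ->
    cap_ess_sup N (ball x r) (fun y => `|u y - mean mu (ball x r) u|) <=
    (C0 * M * (cD * (fine n + e * fine (N rho))))%:E.
  move=> e0; have le := lattice_approx_le x (2 * lam * r) mg mg' mrho g'g e0.
  have Nh : N (fun y => g' y + e%:E * rho y) < +oo.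
    apply: le_lt_trans (qbfl_triangle hX mg' (measurable_funeM _ mrho)) _.
    apply: lte_mul_pinfty; rewrite ?lee_fin//.
    rewrite (qbfl_homogeneous hX)// gtr0_norm// lte_add_pinfty//.
      apply: le_lt_trans Ng; apply: (qbfl_lattice hX) => //.
      by apply: filterS g'g => y ->.
    by apply: lte_mul_pinfty; rewrite // lee_fin ltW.
  apply: le_trans (cap_ess_sup_upper_gradient x r0 mu_u Nu (ugh e e0) Nh) _.
  rewrite [leRHS]EFinM; apply: lee_wpmul2l; first by rewrite lee_fin mulr_ge0.
  apply: le_trans le _.
  by rewrite EFinM EFinD EFinM !fineK.
rewrite -(fineK n_fin); apply/lee_addgt0Pr => e e0.
pose k := (C0 * M * cD * fine (N rho))%R.
have k0 : (0 <= k)%R by do 3!apply: mulr_ge0 => //.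
have e1 : (0 < e / (k + 1))%R by rewrite divr_gt0// ltr_wpDl.
apply: le_trans (bound _ e1) _; rewrite -EFinM -EFinD lee_fin.
rewrite (_ : C0 * M * _ = C0 * cD * M * fine n + k * (e / (k + 1)))%R; last first.
  by rewrite /k; move: (e / _)%R => w; ring.
rewrite lerD2l mulrCA ler_piMr ?(ltW e0)//.
by rewrite ler_pdivrMr ?mul1r ?lerDl// ltr_wpDl.
Qed.

End function_lattice.

(** * Choice of the constants *)

Theorem proposition6p2 (R : realType) (d : measure_display)
  (P : metricMeasurableType d R) (mu : {measure set P -> \bar R})
  (cD : R) (N : (P -> \bar R) -> \bar R) (p s lambda : R)
  (cemb : P -> R -> R)
  (hP : metric_measure_space mu)
  (hmu : doubling mu)
  (hX : quasi_Banach_function_lattice mu cD N)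
  (hs : 0 < s) (hdim : dimension_condition mu s)
  (hp1 : 1 <= p) (hps : s < p)
  (hlambda : 1 <= lambda) (hPI : poincare mu p lambda)
  (hemb : embeds_Lploc mu N p cemb) :
  exists2 C : R, 0 < C &
  forall (x0 : P) (R0 : R), 0 < R0 ->
  let K := cemb x0 (2 * lambda * R0) *
    (R0 `^ s / fine (mu (ball x0 (2 * lambda * R0)))) `^ p^-1 in
  let estimates (cB0 : R) (x : P) (r : R) :=
    let B := ball x r in
    let B2 := ball x (2 * lambda * r) in
    let M := cemb x (2 * lambda * r) * r / fine (mu B2) `^ p^-1 in
    forall u g : P -> \bar R,
      in_newtonian N u -> in_lattice N g -> weak_upper_gradient N g u ->
      (cap_ess_sup N B (fun y => `|u y - mean mu B u|)
         <= (C * M)%:E * N (g \_ B2))%E /\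
      (M%:E * N (g \_ B2) <= (cB0 * r `^ (1 - s / p))%:E * N (g \_ B2))%E in
  (exists2 cB0 : R, 0 < cB0 &
     forall (x : P) (r : R), 0 < r < R0 -> ball x r `<=` ball x0 R0 ->
       estimates cB0 x r) /\
  (* The two-sided bound on cB0 needs 2 lambda B to be contained in 2 lambda B0,
     which does not follow from B being contained in B0 in a general metric
     space when r > R0 / 2, and without which cemb on 2 lambda B is not
     controlled by cemb on 2 lambda B0. *)
  (exists2 cB0 : R, 0 < cB0 /\ C^-1 * K <= cB0 <= C * K &
     forall (x : P) (r : R), 0 < r < R0 -> ball x r `<=` ball x0 R0 ->
       ball x (2 * lambda * r) `<=` ball x0 (2 * lambda * R0) ->
       estimates cB0 x r).
Proof.
have [cdbl cdbl1 Hdbl] := hmu; have [cs cs0 Hdim] := hdim.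
have [cPI cPI0 HPI] := hPI.
have hdbl (x : P) (r : R) : 0 < r -> vol mu x (2 * r) <= cdbl * vol mu x r.
  move=> r0; have r20 : 0 < 2 * r by rewrite mulr_gt0.
  by have := Hdbl x r r0; rewrite !(volE hP)// -EFinM lee_fin.
have lam0 : 0 < lambda := lt_le_trans ltr01 hlambda.
set k := (cs `^ p^-1)^-1.
have k0 : 0 < k by rewrite invr_gt0 powR_gt0.
have k0' := ltW k0; have kV : 0 < k^-1 by rewrite invr_gt0.
have kV0 := ltW kV.
set C0 := sup_const cdbl cs cPI p s.
have C00 : 0 <= C0.
  by apply: sup_const_ge0 => //; exact: le_trans cdbl1.
have cD0 : 0 <= cD by rewrite (le_trans ler01)// (qbfl_modulus hX).
(* The first term serves the capacity estimate; the other two give [C^-1 * K <= k * K <= C * K],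
   where [k] is the constant of [embedding_scale_le]. *)
pose C := C0 * cD + k + k^-1.
have CC0 : C0 * cD <= C by rewrite /C -addrA lerDl addr_ge0 ?(ltW k0).
have Ck : k <= C.
  by rewrite /C addrAC lerDr addr_ge0 ?mulr_ge0.
have CkV : k^-1 <= C by rewrite /C lerDr addr_ge0 ?mulr_ge0 ?(ltW k0).
have C_gt0 : 0 < C := lt_le_trans k0 Ck.
exists C => // x0 R0 R00 K estimates.
(* The radius [R1] of the reference ball is left free: it is [2 * R0] for the first claim and [R0]
   for the second. *)
have grow (R1 : R) (x : P) (r : R) : 0 < r -> r <= R1 ->
    ball x0 (2 * lambda * R1) x ->
    ball x (2 * lambda * r) `<=` ball x0 (2 * lambda * R1) ->
    estimates (k * embedding_growth mu p cemb s lambda x0 R1) x r.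
  move=> r0 rR xx0 sub B B2 M u g uN gN wug; split.
    apply: le_trans (cap_ess_sup_weak_upper_gradient hP hX hp1 hemb cs0 Hdim hlambda
      hdbl hs hps cPI0 HPI x r0 uN gN wug) _.
    apply: lee_wpmul2r.
      by rewrite (qbfl_ge0 hX)//; apply: (measurable_patch_ball hP); case: gN.
    rewrite lee_fin; apply: ler_wpM2r => //.
    exact: (embedding_scale_ge0 hemb hlambda).
  apply: lee_wpmul2r.
    by rewrite (qbfl_ge0 hX)//; apply: (measurable_patch_ball hP); case: gN.
  rewrite lee_fin.
  exact: (embedding_scale_le hP hp1 hemb cs0 Hdim hlambda r0 rR xx0 sub).
have center (x : P) (r : R) : 0 < r -> ball x r `<=` ball x0 R0 -> ball x0 R0 x.
  by move=> r0; apply; exact: ballxx.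
have le2lam (t : R) : 0 < t -> t <= 2 * lambda * t.
  by move=> t0; rewrite ler_peMl ?(ltW t0)//; lra.
split.
  (* With the radius doubled, containment is automatic: points of the dilated ball are within
     [R0 + 2 * lambda * r] of [x0], which is less than [4 * lambda * R0]. *)
  exists (k * embedding_growth mu p cemb s lambda x0 (2 * R0)).
    by rewrite mulr_gt0// (embedding_growth_gt0 hP hemb _ hlambda)// mulr_gt0.
  move=> x r /andP[r0 rR] /(center _ _ r0) xx0.
  have lR : R0 <= lambda * R0 by rewrite ler_peMl// ltW.
  have lrR : lambda * r <= lambda * R0 by rewrite ler_pM2l// ltW.
  move: xx0; rewrite ballEmdist/= => xx0.
  apply: grow => //; [lra|rewrite ballEmdist/=; lra|].
  by apply: ball_sub; lra.
have KE : K = embedding_growth mu p cemb s lambda x0 R0 by [].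
have K0 : 0 < K by rewrite KE (embedding_growth_gt0 hP hemb _ hlambda).
exists (k * K).
  split; first exact: mulr_gt0.
  rewrite !ler_pM2r// Ck andbT -[leRHS]invrK lef_pV2 ?posrE//.
move=> x r /andP[r0 rR] /(center _ _ r0) xx0 sub.
apply: grow => //; first exact: ltW.
move: xx0; rewrite !ballEmdist/= => /lt_le_trans; apply; exact: le2lam.
Qed.
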